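(* Let $n\geq 1$ be an integer and let $1\leq p<\infty$. Then the $p$-Wasserstein sphere $\mathcal{W}_p(\mathbb{S}^n)$ is isometrically rigid, that is, the push-forward operation $\#\colon \mathrm{Isom}(\mathbb{S}^n)\to \mathrm{Isom}(\mathcal{W}_p(\mathbb{S}^n))$, $\psi\mapsto\psi_\#$, is surjective: for every isometry $\Phi\colon\mathcal{W}_p(\mathbb{S}^n)\to\mathcal{W}_p(\mathbb{S}^n)$ there exists an isometry $\psi\colon\mathbb{S}^n\to\mathbb{S}^n$ such that $\Phi(\mu)=\psi_\#\mu$ for all $\mu\in\mathcal{W}_p(\mathbb{S}^n)$.
   Context: The unit sphere is $\mathbb{S}^n=\{x\in\mathbb{R}^{n+1}\colon \|x\|=1\}$ (Euclidean norm), equipped with the angular (geodesic) distance $\sphericalangle(x,y)=\arccos\langle x,y\rangle$. For a complete separable metric space $(X,r)$ and $1\le p<\infty$, the $p$-Wasserstein space $\mathcal{W}_p(X)$ is the set of all Borel probability measures $\mu$ on $X$ with $\int_X r(x,\hat x)^p\,\mathrm{d}\mu(x)<\infty$ for all $\hat x\in X$ (for compact $X$, this is all Borel probability measures), endowed with the distance $$d_{\mathcal{W}_p}(\mu,\nu)=\left(\inf_{\pi\in\Pi(\mu,\nu)}\int_{X\times X} r(x,y)^p\,\mathrm{d}\pi(x,y)\right)^{1/p},$$ where $\Pi(\mu,\nu)$ is the set of Borel probability measures $\pi$ on $X\times X$ (couplings) with $\pi(A\times X)=\mu(A)$ and $\pi(X\times B)=\nu(B)$ for all Borel $A,B\subseteq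 X$. An isometry is a distance-preserving bijection of a metric space onto itself, and $\mathrm{Isom}(\cdot)$ denotes the isometry group. For $\psi\in\mathrm{Isom}(X)$, the push-forward $\psi_\#\colon\mathcal{W}_p(X)\to\mathcal{W}_p(X)$ is $(\psi_\#\mu)(A)=\mu(\psi^{-1}[A])$ for Borel $A\subseteq X$; it is an isometry of $\mathcal{W}_p(X)$. The space $\mathcal{W}_p(X)$ is called isometrically rigid if $\psi\mapsto\psi_\#$ is surjective onto $\mathrm{Isom}(\mathcal{W}_p(X))$. Here $\mathcal{W}_p(\mathbb{S}^n)$ is the $p$-Wasserstein space over $(\mathbb{S}^n,\sphericalangle)$. *)

(* Defs.v *)
From HB Require Import structures.
From mathcomp Require Import all_boot all_order all_algebra.
From mathcomp Require Import all_classical all_reals all_analysis.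
From mathcomp Require Import ring lra.

Set Implicit Arguments.
Unset Strict Implicit.
Unset Printing Implicit Defensive.

Import Order.TTheory GRing.Theory Num.Theory.
Import numFieldNormedType.Exports.

Local Open Scope classical_set_scope.
Local Open Scope ring_scope.

(* Measurable types are pointed in the library, so the base space has to be. *)
#[short(type="pmetricType")]
HB.structure Definition PointedMetric (K : numDomainType) :=
  { M of Metric K M & isPointed M }.

Definition is_isometry (T U : Type) (d : T -> T -> U) (f : T -> T) : Prop :=
  bijective f /\ forall x y, d (f x) (f y) = d x y.

HB.instance Definition _ (T U : ptopologicalType) := Pointed.on (T * U)%type.

Definition borel (T : ptopologicalType) := g_sigma_algebraType (@open T).

Section Wasserstein.
Variables (R : realType) (p : R) (X : pmetricType R).

(* A probability of the library is a function on all subsets, which is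
   unconstrained on the nonmeasurable ones.  Requiring it to vanish there makes
   equality in the Wasserstein space coincide with equality on Borel sets
   (wasserstein_ext). *)
Record wasserstein := Wasserstein {
  wmeasure :> probability (borel X) R ;
  _ : forall A : set (borel X), ~ measurable A -> wmeasure A = 0%E ;
  _ : forall a : X, (\int[wmeasure]_x ((mdist x a) `^ p)%:E < +oo)%E }.

(* The sigma-algebra on X * X is the Borel one of the product topology. *)
Definition coupling (mu nu : probability (borel X) R) :
    set (probability (borel (X * X)%type) R) :=
  [set pi | (forall A : set (borel X), measurable A -> pi (A `*` setT) = mu A)
         /\ (forall B : set (borel X), measurable B -> pi (setT `*` B) = nu B)].

Definition wasserstein_dist (mu nu : wasserstein) : \bar R :=
  poweR (ereal_inf [set (\int[pi]_z ((mdist z.1 z.2) `^ p)%:E)%E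
                   | pi in coupling mu nu]) p^-1.

Definition isometrically_rigid : Prop :=
  forall Phi : wasserstein -> wasserstein,
    is_isometry wasserstein_dist Phi ->
    exists2 psi : X -> X, is_isometry (@mdist R X) psi &
      forall (mu : wasserstein) (A : set (borel X)), measurable A ->
        Phi mu A = pushforward mu (psi : borel X -> borel X) A.

Lemma wasserstein_ext (mu nu : wasserstein) :
  (forall A : set (borel X), measurable A -> mu A = nu A) -> mu = nu.
Proof.
case: mu nu => [mu mu0 muoo] [nu nu0 nuoo] /= munu.
have {}munu : (mu : set (borel X) -> \bar R) = nu.
  apply/funext => A; have [mA|mA] := pselect (measurable A); first exact: munu.
  by rewrite mu0// nu0.
case: mu nu munu mu0 muoo nu0 nuoo => [m c] [m' c'] /= mm'.
move=> mu0 muoo nu0 nuoo; subst m'.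
have cc' : c = c'.
  clear mu0 muoo nu0 nuoo.
  case: c c' => [[c1 c1'] [c2] [c3] [c4] [c5] [c6] [c7]].
  move=> [[d1 d1'] [d2] [d3] [d4] [d5] [d6] [d7]].
  have e1 : c1 = d1 by exact: Prop_irrelevance.
  have e1' : c1' = d1' by exact: Prop_irrelevance.
  subst d1 d1'.
  by f_equal; f_equal; exact: Prop_irrelevance.
subst c'.
by congr Wasserstein; exact: Prop_irrelevance.
Qed.

End Wasserstein.

Section dot_product.
Variables (R : realType) (m : nat).
Implicit Types (x y z : 'rV[R]_m) (a : R).

Definition dot x y : R := \sum_(i < m) x 0 i * y 0 i.

Definition enorm x : R := Num.sqrt (dot x x).

Lemma dotC x y : dot x y = dot y x.
Proof. by apply: eq_bigr => i _; rewrite mulrC. Qed.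

Lemma dotBl x y z : dot (x - y) z = dot x z - dot y z.
Proof.
by rewrite /dot -sumrB; apply: eq_bigr => i _; rewrite !mxE mulrBl.
Qed.

Lemma dotZl a x y : dot (a *: x) y = a * dot x y.
Proof. by rewrite /dot mulr_sumr; apply: eq_bigr => i _; rewrite mxE mulrA. Qed.

Lemma dotBr x y z : dot z (x - y) = dot z x - dot z y.
Proof. by rewrite dotC dotBl !(dotC z). Qed.

Lemma dotZr a x y : dot x (a *: y) = a * dot x y.
Proof. by rewrite dotC dotZl dotC. Qed.

Lemma dot_ge0 x : 0 <= dot x x.
Proof. by apply: sumr_ge0 => i _; rewrite -expr2 sqr_ge0. Qed.

Lemma dot_eq0 x : dot x x = 0 -> x = 0.
Proof.
move=> /eqP; rewrite psumr_eq0; last by move=> i _; rewrite -expr2 sqr_ge0.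
move=> /allP x0; apply/rowP => i; rewrite mxE; apply/eqP.
by rewrite -sqrf_eq0 expr2; apply: (x0 i); rewrite mem_index_enum.
Qed.

Lemma dot_CauchySchwarz x y : dot x y ^+ 2 <= dot x x * dot y y.
Proof.
have [/dot_eq0 ->|y0] := eqVneq (dot y y) 0.
  have d0 z : dot z 0 = 0 by rewrite -(scale0r (0 : 'rV[R]_m)) dotZr mul0r.
  by rewrite !d0 mulr0 expr0n.
have {}y0 : 0 < dot y y by rewrite lt_neqAle eq_sym y0 dot_ge0.
have := dot_ge0 (dot y y *: x - dot x y *: y).
rewrite dotBl !dotBr !dotZl !dotZr (dotC y x) => h.
rewrite -subr_ge0 -(pmulr_rge0 _ y0).
by apply: le_trans h _; rewrite le_eqVlt; apply/orP; left; apply/eqP; ring.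
Qed.

End dot_product.

Section sphere.
Variables (R : realType) (n : nat).

(* The unit sphere of dimension n, in R^(n+1). *)
Definition sphere := {x : 'rV[R]_n.+1 | enorm x == 1}.

HB.instance Definition _ := Choice.on sphere.

Definition angle (x y : sphere) : R := acos (dot (val x) (val y)).

Implicit Types x y z : sphere.

Lemma sphere_dot1 x : dot (val x) (val x) = 1.
Proof.
have /eqP x1 := valP x.
by rewrite -[LHS]sqr_sqrtr ?dot_ge0// -/(enorm _) x1 expr1n.
Qed.

Lemma sphere_dot_itv x y : -1 <= dot (val x) (val y) <= 1.
Proof.
have := dot_CauchySchwarz (val x) (val y); rewrite !sphere_dot1 mulr1 => h.
by rewrite -ler_norml -(@ler_pXn2r _ 2)// ?nnegrE// real_normK ?num_real// expr1n.
Qed.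

Lemma cos_angle x y : cos (angle x y) = dot (val x) (val y).
Proof. by have [] := acos_def (sphere_dot_itv x y). Qed.

Lemma angle_itv x y : 0 <= angle x y <= pi.
Proof. by have [] := acos_def (sphere_dot_itv x y). Qed.

Lemma anglexx x : angle x x = 0.
Proof. by rewrite /angle sphere_dot1 acos1. Qed.

Lemma angle_sym x y : angle x y = angle y x.
Proof. by rewrite /angle dotC. Qed.

Lemma angle_positivity x y : angle x y = 0 -> x = y.
Proof.
move=> /(congr1 cos); rewrite cos_angle cos0 => xy1.
apply/val_inj/eqP; rewrite -subr_eq0; apply/eqP/dot_eq0.
by rewrite dotBl !dotBr (dotC _ (val x)) xy1 !sphere_dot1; lra.
Qed.

Lemma angle_triangle y x z : angle x z <= angle x y + angle y z.
Proof.
have /andP[a0 api] := angle_itv x y; have /andP[b0 bpi] := angle_itv y z.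
have /andP[c0 cpi] := angle_itv x z.
have [|abpi] := leP pi (angle x y + angle y z); first exact: le_trans.
rewrite leNgt; apply/negP => abc.
have : cos (angle x z) < cos (angle x y + angle y z).
  by rewrite ltr_cos// in_itv/= ?c0 ?cpi ?addr_ge0 ?(ltW abpi).
apply/negP; rewrite -leNgt cosD -subr_ge0.
have sa := sin_ge0_pi (angle_itv x y); have sb := sin_ge0_pi (angle_itv y z).
have sa2 := sin2cos2 (angle x y); have sb2 := sin2cos2 (angle y z).
rewrite !cos_angle in sa2 sb2 *.
have := dot_CauchySchwarz (val x - dot (val x) (val y) *: val y)
  (val z - dot (val y) (val z) *: val y).
rewrite !dotBl !dotBr !dotZl !dotZr !sphere_dot1.
rewrite (dotC (val y) (val x)) (dotC (val z) (val y)).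
set c := dot (val x) (val z); set a := dot (val x) (val y) in sa2 *.
set b := dot (val y) (val z) in sb2 *.
set s := sin _ in sa sa2 *; set t := sin _ in sb sb2 *.
move=> CS.
have {}CS : (c - a * b) ^+ 2 <= (s * t) ^+ 2.
  by rewrite exprMn sa2 sb2; apply: le_trans (le_trans CS _); nra.
have : `|c - a * b| <= s * t.
  rewrite -(@ler_pXn2r _ 2)// ?nnegrE ?mulr_ge0//.
  by rewrite real_normK ?num_real.
by rewrite ler_norml => /andP[? _]; lra.
Qed.

HB.instance Definition _ := @isMetric.Build R sphere angle
  anglexx angle_positivity angle_sym angle_triangle.

Lemma sphere_pole_subproof : enorm (delta_mx 0 0 : 'rV[R]_n.+1) == 1.
Proof.
rewrite /enorm /dot (bigD1 ord0)//= !mxE eqxx mulr1 big1 ?addr0 ?sqrtr1//.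
by move=> i /negPf i0; rewrite !mxE i0 mulr0.
Qed.

HB.instance Definition _ := isPointed.Build sphere
  (exist (fun x : 'rV[R]_n.+1 => enorm x == 1) _ sphere_pole_subproof).

End sphere.

(* Main.v *)
(* The diameter pi of the Wasserstein space is attained only between the Dirac
   measures at two antipodal points, so an isometry Phi permutes Dirac measures
   and thereby induces an isometry psi of the sphere.  The distances from mu to
   the Dirac measures are given by the potential x |-> \int r(z, x)^p dmu(z), so
   Phi(mu) and psi_# mu have the same potential.  Along a great circle through
   -y, the symmetric second difference quotient of the potential at -y tends to
   -2 p pi^(p-1) mu{y}, plus 2 mu{-y} when p = 1, because r(z, .)^p is
   differentiable away from z and -z.  Hence a finitely supported measure with
   no antipodal pair in its support is determined by its potential, and Phi
   agrees with psi_# on such measures; they are dense. *)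

Require Import Defs.
From HB Require Import structures.
From mathcomp Require Import all_boot all_order all_algebra.
From mathcomp Require Import all_classical all_reals all_analysis.
From mathcomp Require Import measurable_realfun.
From mathcomp Require Import ring lra.

Set Implicit Arguments.
Unset Strict Implicit.
Unset Printing Implicit Defensive.

Import Order.TTheory GRing.Theory Num.Theory.
Import numFieldNormedType.Exports.

Local Open Scope classical_set_scope.
Local Open Scope ring_scope.

(** * Borel sets of a metric space *)

(** For [p = 1] the potential does not determine a measure: the equal mixture of the Dirac measures
    at [y] and [-y] has constant potential [pi / 2], whatever [y] is, and the second differences see
    only the difference of the two masses. This is why antipodal pairs are kept out of the support
    and density is invoked. The restriction falls on one of the two measures only: if [mu{-y} = 0],
    the limit gives [mu{y} <= nu{y}] for every [nu] with the same potential, and equal total masses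
    turn such inequalities into equalities. So nothing has to be known in advance about the support
    of [Phi(mu)]. The diameter is exploited through the product measure: if the infimum of the costs
    is [pi^p], the independent coupling also costs [pi^p], so almost all of its pairs are antipodal.
    Density enters in the form that two measures with arbitrarily cheap transport to a common third
    one coincide, which is proved by comparing masses of closed sets and of their neighbourhoods. *)

Section borel_metric.
Variable R : realType.

Lemma continuous_measurable_fun_real (T : ptopologicalType) (f : T -> R) :
  continuous f -> measurable_fun setT (f : borel T -> R).
Proof.
move=> /continuousP cf; apply: (measurability _ (RGenOpens.measurableE R)).
move=> _ [_ [a [b ->] <-]]; rewrite setTI; apply: sub_sigma_algebra.
exact/cf/interval_open.
Qed.

Lemma continuous_measurable_fun_borel (T U : ptopologicalType) (f : T -> U) :
  continuous f -> measurable_fun setT (f : borel T -> borel U).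
Proof.
move=> /continuousP cf; apply: (measurability (f := f : borel T ->
  borel U) (@open U)) => //.
by move=> _ [A oA <-]; rewrite setTI; apply: sub_sigma_algebra; exact: cf.
Qed.

Variable X : pmetricType R.

Lemma mdist_lipschitz (x y x' y' : X) :
  `|mdist x y - mdist x' y'| <= mdist x x' + mdist y y'.
Proof.
have h1 := metric_triangle x x' y; have h2 := metric_triangle x' y' y.
have h3 := metric_triangle x' x y'; have h4 := metric_triangle x y y'.
rewrite (metric_sym x' x) in h3; rewrite (metric_sym y' y) in h2.
by rewrite ler_norml; apply/andP; split; lra.
Qed.

Lemma continuous_mdist : continuous (fun z : X * X => mdist z.1 z.2).
Proof.
move=> [x y]; apply/cvgrPdist_lt => e e0.
have e20 : 0 < e / 2 by rewrite divr_gt0.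
exists (ball x (e / 2), ball y (e / 2)); first by split; exact: nbhsx_ballx.
move=> [x' y'] /= []; rewrite !ballEmdist /= => xx' yy'.
by apply: le_lt_trans (mdist_lipschitz x y x' y') _; lra.
Qed.

Lemma mdist_continuous (f : X -> R) :
  (forall x e, 0 < e -> exists2 d, 0 < d &
     forall y, mdist x y < d -> `|f x - f y| < e) -> continuous f.
Proof.
move=> fP x; apply/cvgrPdist_lt => e /(fP x)[d d0 dP].
by apply/nbhs_ballP; exists d => // y; rewrite ballEmdist/=; exact: dP.
Qed.

Lemma isometry_continuous (f : X -> X) :
  (forall x y, mdist (f x) (f y) = mdist x y) -> continuous f.
Proof.
move=> fP x A /nbhs_ballP[e /= e0 eA].
by apply/nbhs_ballP; exists e => // y xy; apply: eA; move: xy;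
  rewrite !ballEmdist/= fP.
Qed.

Lemma continuous_mdistl (a : X) : continuous (fun x : X => mdist x a).
Proof.
apply: mdist_continuous => x e e0; exists e => // y xy.
by apply: le_lt_trans (mdist_lipschitz x a y a) _; rewrite mdistxx addr0.
Qed.

Lemma measurable_mdist_powR (p : R) :
  measurable_fun setT (fun z : borel (X * X)%type => mdist z.1 z.2 `^ p).
Proof.
apply: (@measurableT_comp _ _ _ _ _ _ (fun r : R => r `^ p));
  first exact: measurable_powR.
exact: (continuous_measurable_fun_real continuous_mdist).
Qed.

Lemma measurable_mdistl_powR (p : R) (a : X) :
  measurable_fun setT (fun x : borel X => mdist x a `^ p).
Proof.
apply: (@measurableT_comp _ _ _ _ _ _ (fun r : R => r `^ p));
  first exact: measurable_powR.
exact: (continuous_measurable_fun_real (@continuous_mdistl a)).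
Qed.

Lemma measurable_borel_set1 (a : X) : measurable ([set a] : set (borel X)).
Proof.
rewrite -(setCK [set a]); apply: measurableC; apply: sub_sigma_algebra.
apply: closed_openC; apply: accessible_closed_set1.
by apply: hausdorff_accessible; exact: metric_hausdorff.
Qed.

Lemma finite_borel_measurable (F : set (borel X)) : finite_set F ->
  measurable F.
Proof.
move=> finF; rewrite -[F]image_id -bigcup_imset1.
by apply: fin_bigcup_measurable => // x _; exact: measurable_borel_set1.
Qed.

(** Total boundedness with Borel cells, encoded as a colouring so that the cells are disjoint. It
    serves twice: to describe the Borel sets of the square by products of cells, and to discretize
    measures in the density argument. *)
Definition finely_partitionable : Prop := forall e : R, 0 < e ->
  exists (k : nat) (c : borel X -> 'I_k),
    (forall i, measurable (c @^-1` [set i])) /\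
    (forall x y, c x = c y -> mdist x y < e).

Hypothesis fpX : finely_partitionable.

(* An open subset of the square is a countable union of products of cells. *)
Lemma open_measurable_prod (U : set (X * X)) :
  open U -> measurable (U : set (borel X * borel X)).
Proof.
move=> oU.
have kc (n : nat) : {k : nat & {c : borel X -> 'I_k |
    (forall i, measurable (c @^-1` [set i])) /\
    (forall x y, c x = c y -> mdist x y < n.+1%:R^-1)}}.
  have n0 : (0 : R) < n.+1%:R^-1 by rewrite invr_gt0.
  by have /cid[k /cid[c cP]] := fpX n0; exists k, c.
pose k n := projT1 (kc n); pose c n : borel X -> 'I_(k n) :=
  sval (projT2 (kc n)).
have cP n : (forall i, measurable (c n @^-1` [set i])) /\
    (forall x y, c n x = c n y -> mdist x y < n.+1%:R^-1).
  exact: (svalP (projT2 (kc n))).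
have -> : U = \bigcup_n \bigcup_(ij in [set ij : 'I_(k n) * 'I_(k n) |
    (c n @^-1` [set ij.1]) `*` (c n @^-1` [set ij.2]) `<=` U])
    ((c n @^-1` [set ij.1]) `*` (c n @^-1` [set ij.2])).
  apply/seteqP; split; last by move=> z [n _ [ij /= ijU /ijU]].
  move=> [x y] Uxy; have : nbhs (x, y) U by exact: open_nbhs_nbhs.
  move=> [[A B] /= [/nbhs_ballP[a /= a0 aA] /nbhs_ballP[b /= b0 bB]] ABU].
  have [n nab] : exists n : nat, n.+1%:R^-1 < Num.min a b.
    have ab0 : 0 < Num.min a b by rewrite lt_min a0.
    have [N _ /(_ N)/(_ (leqnn _)) Nab] := near_infty_natSinv_lt (PosNum ab0).
    by exists N.
  move: nab; rewrite lt_min => /andP[na nb].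
  exists n => //; exists (c n x, c n y) => //= -[x' y'] /= [cx cy].
  apply: ABU; split; [apply: aA|apply: bB]; rewrite ballEmdist/=.
    by apply: lt_trans na; apply: (cP n).2.
  by apply: lt_trans nb; apply: (cP n).2.
apply: bigcup_measurable => n _; apply: fin_bigcup_measurable => // ij _.
by apply: measurableX; exact: (cP n).1.
Qed.

(** Couplings live on the Borel sigma-algebra of the product topology, whereas product measures and
    pairs of measurable maps live on the product sigma-algebra; this inclusion lets one pass from
    the second to the first. *)
Lemma borel_prod_measurable (A : set (borel (X * X)%type)) :
  measurable A -> measurable (A : set (borel X * borel X)).
Proof.
move: A; apply: smallest_sub; first exact: sigma_algebra_measurable.
by move=> U; exact: open_measurable_prod.
Qed.

Lemma measurable_fun_borel_pair d (T : measurableType d) (f g : T -> borel X) :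
  measurable_fun setT f -> measurable_fun setT g ->
  measurable_fun setT ((fun t => (f t, g t)) : T -> borel (X * X)%type).
Proof.
move=> mf mg _ A /borel_prod_measurable mA.
exact: (measurable_fun_pair mf mg).
Qed.

Lemma measurable_fst_borel :
  measurable_fun setT (fst : borel (X * X)%type -> borel X).
Proof. by apply: (@continuous_measurable_fun_borel (X * X)%type) => ?;
  exact: cvg_fst. Qed.

Lemma measurable_snd_borel :
  measurable_fun setT (snd : borel (X * X)%type -> borel X).
Proof. by apply: (@continuous_measurable_fun_borel (X * X)%type) => ?;
  exact: cvg_snd. Qed.

End borel_metric.

(** * Wasserstein spaces of bounded, finely partitionable metric spaces *)

Section probability_lemmas.
Variable R : realType.

Lemma pushforward_probability d d' (T : measurableType d)
    (T' : measurableType d') (P : probability T R) (f : T -> T') :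
  measurable_fun setT f ->
  exists Q : probability T' R, (Q : set T' -> \bar R) = pushforward P f.
Proof.
move=> mf; pose F : {mfun T >-> T'} := HB.pack f (isMeasurableFun.Build _ _ _ _
  _ mf).
by exists (distribution P F).
Qed.

Lemma ae_exists d (T : measurableType d) (P : probability T R) (Q : T -> Prop) :
  {ae P, forall x, Q x} -> exists x, Q x.
Proof.
move=> [N [mN N0 QN]]; apply: contrapT => /forallNP nQ.
have NT : N = setT by apply/seteqP; split => // x _; apply: QN; exact: nQ.
by move: N0; rewrite NT probability_setT => /eqP; rewrite onee_eq0.
Qed.

Lemma probability_eq1 d (T : measurableType d) (P : probability T R)
    (A : set T) : measurable A -> (P A = 1 <-> P (~` A) = 0)%E.
Proof.
move=> mA; have fA : P A \is a fin_num by exact: fin_num_measure.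
rewrite probability_setC//; split => [->|]; first by rewrite subee.
by move=> /eqP; rewrite sube_eq// add0e => /eqP.
Qed.

(** The inequality on the complement is the reverse inequality, because both masses are 1. *)
Lemma probability_eq_of_le d (T : measurableType d) (P Q : probability T R) :
  (forall A, measurable A -> P A <= Q A)%E ->
  forall A, measurable A -> P A = Q A.
Proof.
move=> PQ A mA; apply/eqP; rewrite eq_le PQ//=.
have := PQ _ (measurableC mA); rewrite !probability_setC//.
by rewrite leeD2lE// leeN2.
Qed.

End probability_lemmas.

Section wasserstein_bounded.
Variables (R : realType) (X : pmetricType R) (p D : R).
Hypotheses (p1 : 1 <= p) (mdistD : forall x y : X, mdist x y <= D).
Hypothesis fpX : finely_partitionable X.

Let p0 : 0 < p. Proof. exact: lt_le_trans ltr01 p1. Qed.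

Let mdist_powRD (x y : X) : mdist x y `^ p <= D `^ p.
Proof.
by apply: ge0_ler_powR; rewrite ?nnegrE ?mdist_ge0 ?(ltW p0)//;
  exact: le_trans (mdist_ge0 _ _) (mdistD x y).
Qed.

(* Elements of the Wasserstein space vanish on nonmeasurable sets. *)
Definition truncate (m : set (borel X) -> \bar R) (A : set (borel X)) :
  \bar R :=
  if `[< measurable A >] then m A else 0%E.

Section truncate.
Variable m : probability (borel X) R.

Let trunc0 : truncate m set0 = 0%E.
Proof. by rewrite /truncate; case: ifP => // _; rewrite measure0. Qed.

Let trunc_ge0 A : (0 <= truncate m A)%E.
Proof. by rewrite /truncate; case: ifP. Qed.

Let trunc_sigma_additive : semi_sigma_additive (truncate m).
Proof.
move=> F mF tF mUF; rewrite /truncate asboolT//.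
rewrite (_ : (fun n => _) = fun n => (\sum_(0 <= i < n) m (F i))%E).
  exact: measure_semi_sigma_additive.
by apply/funext => n; apply: eq_bigr => i _; rewrite asboolT.
Qed.

HB.instance Definition _ := isMeasure.Build _ _ _ (truncate m)
  trunc0 trunc_ge0 trunc_sigma_additive.

Let truncT : truncate m setT = 1%E.
Proof. by rewrite /truncate asboolT// probability_setT. Qed.

HB.instance Definition _ := Measure_isProbability.Build _ _ _ (truncate m)
  truncT.

End truncate.

Lemma wasserstein_of_probability (m : probability (borel X) R) :
  exists mu : wasserstein p X, forall A, measurable A -> mu A = m A.
Proof.
have trunc0 (A : set (borel X)) : ~ measurable A -> truncate m A = 0%E.
  by move=> mA; rewrite /truncate asboolF.
have truncoo (a : X) : (\int[truncate m]_x ((mdist x a) `^ p)%:E < +oo)%E.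
  apply: (@le_lt_trans _ _ (\int[truncate m]_x (D `^ p)%:E)%E).
    apply: ge0_le_integral => //.
    - by move=> x _; rewrite lee_fin powR_ge0.
    - by apply/measurable_EFinP; exact: measurable_mdistl_powR.
    - by move=> x _; rewrite lee_fin.
  by rewrite integral_cst//= probability_setT mule1 ltry.
exists (@Wasserstein _ _ _ (truncate m : probability (borel X) R) trunc0
  truncoo).
by move=> A mA /=; rewrite /truncate asboolT.
Qed.

(** * Couplings and optimal transport costs *)

Definition transport_cost (pi : set (borel (X * X)%type) -> \bar R) : \bar R :=
  (\int[pi]_z ((mdist z.1 z.2) `^ p)%:E)%E.

Definition optimal_cost (mu nu : probability (borel X) R) : \bar R :=
  ereal_inf [set transport_cost pi | pi in coupling mu nu].

Lemma wasserstein_distE (mu nu : wasserstein p X) :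
  wasserstein_dist mu nu = poweR (optimal_cost mu nu) p^-1.
Proof. by []. Qed.

Lemma transport_cost_ge0 (pi : probability (borel (X * X)%type) R) :
  (0 <= transport_cost pi)%E.
Proof. by apply: integral_ge0 => z _; rewrite lee_fin powR_ge0. Qed.

Lemma optimal_cost_ge0 mu nu : (0 <= optimal_cost mu nu)%E.
Proof. by apply: le_ereal_inf_tmp => _ [pi _ <-];
  exact: transport_cost_ge0. Qed.

Lemma optimal_cost_le mu nu pi : coupling mu nu pi ->
  (optimal_cost mu nu <= transport_cost pi)%E.
Proof. by move=> cpi; apply: ereal_inf_lbound; exists pi. Qed.

(** Taking the power [p^-1] is injective on nonnegative extended reals, so an isometry can be
    handled through costs, without roots. *)
Lemma optimal_cost_eq (mu nu mu' nu' : wasserstein p X) :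
  wasserstein_dist mu nu = wasserstein_dist mu' nu' <->
  optimal_cost mu nu = optimal_cost mu' nu'.
Proof.
rewrite !wasserstein_distE; split => [|-> //].
move=> /(congr1 (fun x => poweR x p)); rewrite -!poweRrM mulVf ?gt_eqF//.
by rewrite !poweRe1// optimal_cost_ge0.
Qed.

(** Every coupling constructed below is the joint law of two maps on one probability space: the
    identity and a constant, the projections of a product measure, the swapped projections, or a map
    and its discretization. *)
Lemma coupling_of_pair d (T : measurableType d) (P : probability T R)
    (f g : T -> borel X) (mu nu : probability (borel X) R) :
  measurable_fun setT f -> measurable_fun setT g ->
  (forall A, measurable A -> mu A = P (f @^-1` A)) ->
  (forall A, measurable A -> nu A = P (g @^-1` A)) ->
  exists2 pi, coupling mu nu pi &
    transport_cost pi = (\int[P]_t ((mdist (f t) (g t)) `^ p)%:E)%E.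
Proof.
move=> mf mg muf nug; have mfg := measurable_fun_borel_pair fpX mf mg.
have [pi piE] := pushforward_probability P mfg.
exists pi.
  split => [A mA|B mB]; rewrite piE /pushforward ?muf// ?nug//; congr (P _);
    by apply/seteqP; split => x /= ; tauto.
rewrite /transport_cost piE ge0_integral_pushforward//.
- by apply/measurable_EFinP; exact: measurable_mdist_powR.
- by move=> z _; rewrite lee_fin powR_ge0.
Qed.

Lemma integral_coupling1 (mu nu : probability (borel X) R) pi
    (f : borel X -> \bar R) : coupling mu nu pi ->
  measurable_fun setT f -> (forall x, 0 <= f x)%E ->
  (\int[pi]_z f z.1 = \int[mu]_x f x)%E.
Proof.
move=> [pi1 _] mf f0.
have [Q QE] := pushforward_probability pi (@measurable_fst_borel _ X).
transitivity (\int[Q]_x f x)%E.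
  rewrite QE ge0_integral_pushforward//; exact: measurable_fst_borel.
apply: eq_measure_integral => A mA _; transitivity (pi (A `*` setT));
  last exact: pi1.
transitivity (Q A); first by [].
by rewrite QE /pushforward; congr (pi _); apply/seteqP; split => x /= ; tauto.
Qed.

(** Under any coupling the second component is almost surely [y], so all couplings have the same
    cost. This is how distances to Dirac measures become values of the potential. *)
Lemma optimal_cost_dirac (mu nu : probability (borel X) R) (y : X) :
  nu [set y] = 1%E ->
  optimal_cost mu nu = (\int[mu]_x ((mdist x y) `^ p)%:E)%E.
Proof.
move=> nuy.
have nuE A : measurable A -> nu A = mu ((fun=> y) @^-1` A).
  move=> mA; rewrite preimage_cst; case: ifPn => [/set_mem yA|/negP yA].
    apply/eqP; rewrite probability_setT eq_le probability_le1//= -nuy.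
    apply: le_measure; rewrite ?inE//; first exact: measurable_borel_set1.
    by move=> _ ->.
  rewrite measure0; apply/eqP; rewrite -measure_le0.
  have /probability_eq1 : nu [set y] = 1%E by [].
  move=> /(_ (@measurable_borel_set1 _ X y)) <-.
  apply: le_measure; rewrite ?inE//.
    by apply: measurableC; exact: measurable_borel_set1.
  by move=> z Az /= zy; apply: yA; rewrite inE -zy.
have costE pi : coupling mu nu pi ->
    transport_cost pi = (\int[mu]_x ((mdist x y) `^ p)%:E)%E.
  move=> cpi; rewrite -(integral_coupling1 cpi); last 2 first.
  - by apply/measurable_EFinP; exact: measurable_mdistl_powR.
  - by move=> x; rewrite lee_fin powR_ge0.
  apply: ae_eq_integral => //.
  - by apply/measurable_EFinP; exact: measurable_mdist_powR.
  - apply/measurable_EFinP.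
    apply: (@measurableT_comp _ _ _ _ _ _ (fun x : borel X => mdist x y `^ p)).
      exact: measurable_mdistl_powR.
    exact: measurable_fst_borel.
  exists (setT `*` (~` [set y])); split.
  - rewrite -(setTI (_ `*` _)) setTX; apply: measurable_snd_borel => //.
    by apply: measurableC; exact: measurable_borel_set1.
  - transitivity (nu (~` [set y])).
      by apply: cpi.2; apply: measurableC; exact: measurable_borel_set1.
    by apply/probability_eq1 => //; exact: measurable_borel_set1.
  - move=> [x z] /= h; split => // zy; apply: h => _.
    by rewrite zy.
(* A coupling has to be exhibited, since the infimum over an empty set would be [+oo]. *)
have [pi cpi _] := @coupling_of_pair _ _ mu id (fun=> y) mu nu
  (@measurable_id _ _ _) (measurable_cst _) (fun A mA => erefl) nuE.
apply/eqP; rewrite eq_le -{1}(costE _ cpi) optimal_cost_le//=.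
by apply: le_ereal_inf_tmp => _ [pi' cpi' <-]; rewrite costE.
Qed.

(** The product measure is a coupling, so its cost is at least [D^p], while the integrand is at most
    [D^p]: hence the distance is [D] almost everywhere for [mu \x nu]. By Fubini some [x] has a
    [nu]-null exceptional section. Quantifying over measurable supersets [A] spares the
    measurability of the set of points at distance [D]. *)
Lemma optimal_cost_diameter (mu nu : probability (borel X) R) :
  0 <= D -> optimal_cost mu nu = (D `^ p)%:E ->
  exists x : X, forall A : set (borel X), measurable A ->
    [set y | mdist x y = D] `<=` A -> nu A = 1%E.
Proof.
move=> D0 DE.
pose P : probability (borel X * borel X)%type R := (mu \x nu)%E.
have P1 A : measurable A -> mu A = P (fst @^-1` A).
  move=> mA; rewrite -setXT [RHS]product_measure1E//.
  by rewrite [X in (_ * X)%E](_ : _ = 1%E) ?mule1//; exact: probability_setT.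
have P2 A : measurable A -> nu A = P (snd @^-1` A).
  move=> mA; rewrite -setTX [RHS]product_measure1E//.
  by rewrite [X in (X * _)%E](_ : _ = 1%E) ?mul1e//; exact: probability_setT.
have [pi cpi piE] := coupling_of_pair measurable_fst measurable_snd P1 P2.
have := optimal_cost_le cpi; rewrite DE piE => leD.
have mr : measurable_fun setT
    (fun z : borel X * borel X => mdist z.1 z.2 `^ p).
  move=> _ A mA; have := @measurable_mdist_powR _ X p measurableT A mA.
  by rewrite !setTI; exact: borel_prod_measurable.
have mDr : measurable_fun setT
    (fun z : borel X * borel X => D `^ p - mdist z.1 z.2 `^ p).
  by apply: measurable_funB.
have int0 : (\int[P]_z `|(D `^ p - mdist z.1 z.2 `^ p)%:E| = 0)%E.
  under eq_integral do rewrite abse_EFin ger0_norm ?subr_ge0//.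
  have : (\int[P]_z (D `^ p - mdist z.1 z.2 `^ p)%:E +
          \int[P]_z (mdist z.1 z.2 `^ p)%:E = (D `^ p)%:E)%E.
    rewrite -ge0_integralD//.
    - under eq_integral do rewrite -EFinD subrK.
      by rewrite integral_cst//= probability_setT mule1.
    - by move=> z _; rewrite lee_fin subr_ge0.
    - exact/measurable_EFinP.
    - by move=> z _; rewrite lee_fin powR_ge0.
    - exact/measurable_EFinP.
  move=> sumE; apply/eqP; rewrite eq_le integral_ge0 ?andbT; last first.
    by move=> z _; rewrite lee_fin subr_ge0.
  rewrite -(@leeD2rE _ (D `^ p)%:E)// add0e -[leRHS]sumE.
  exact: leeD2l.
have [N [mN PN0 subN]] : ae_eq P setT (EFin \o
    (fun z : borel X * borel X => D `^ p - mdist z.1 z.2 `^ p)) (cst 0%E).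
  apply/(ae_eq_integral_abs P measurableT); last exact: int0.
  exact/measurable_EFinP.
have /ae_exists[x Nx0] : {ae mu, forall x, nu (xsection N x) = 0%E}.
  have /(ae_eq_integral_abs mu measurableT) : 
      measurable_fun setT (fun x => nu (xsection N x)).
    exact: measurable_fun_xsection.
  move=> [h _]; have {}h : ae_eq mu setT (fun x => nu (xsection N x)) (cst 0%E).
    apply: h; rewrite -[RHS]PN0; apply: eq_integral => x _.
    by rewrite gee0_abs.
  by apply: filterS h => x /(_ Logic.I).
exists x => A mA DA; apply/probability_eq1 => //.
apply/eqP; rewrite -measure_le0 -Nx0.
apply: le_measure; rewrite ?inE//; first exact: measurableC.
  exact: measurable_xsection.
move=> y Ay; rewrite /xsection/= inE; apply: subN => /= /(_ Logic.I) [].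
move=> /eqP; rewrite subr_eq0 => /eqP /esym Dxy; apply: Ay; apply: DA => /=.
by apply: (powR_injective p0) Dxy; rewrite nnegrE// mdist_ge0.
Qed.

Lemma optimal_cost_sym mu nu : optimal_cost mu nu = optimal_cost nu mu.
Proof.
suff le mu' nu' : (optimal_cost mu' nu' <= optimal_cost nu' mu')%E.
  by apply/eqP; rewrite eq_le !le.
apply: le_ereal_inf_tmp => _ [pi [pi1 pi2] <-].
have pi1' A : measurable A -> nu' A = pi (fst @^-1` A).
  by move=> mA; rewrite -setXT; exact: esym (pi1 _ mA).
have pi2' A : measurable A -> mu' A = pi (snd @^-1` A).
  by move=> mA; rewrite -setTX; exact: esym (pi2 _ mA).
have [pi' cpi' pi'E] := coupling_of_pair (@measurable_snd_borel _ X)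
  (@measurable_fst_borel _ X) pi2' pi1'.
apply: le_trans (optimal_cost_le cpi') _; rewrite pi'E.
by under eq_integral do rewrite metric_sym.
Qed.

(** * Neighbourhoods of sets, and separation of measures by the cost *)

Definition fatten (A : set X) (e : R) : set X :=
  \bigcup_(x in A) [set y | mdist x y < e].

Lemma open_fatten A e : open (fatten A e).
Proof.
apply: bigcup_open => x _; rewrite openE => y /= xye.
apply/nbhs_ballP; exists (e - mdist x y) => /=; first by rewrite subr_gt0.
move=> z; rewrite ballEmdist/= => yz.
by apply: le_lt_trans (metric_triangle x y z) _; rewrite -ltrBrDl.
Qed.

(** Control of the Levy-Prokhorov distance by the cost: by Markov's inequality, a coupling cheaper
    than [e^p * e] moves mass at most [e] by a distance [e] or more, and the rest of [A] stays
    within [fatten A e]. *)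
Lemma optimal_cost_lt_fatten (mu nu : probability (borel X) R) (e : R) :
  0 < e -> (optimal_cost mu nu < (e `^ p * e)%:E)%E ->
  forall A : set (borel X), measurable A ->
  (mu A <= nu (fatten A e : set (borel X)) + e%:E)%E.
Proof.
move=> e0 /ereal_inf_lt[_ [pi [pi1 pi2] <-] cost_lt] A mA.
pose f (z : borel (X * X)%type) : \bar R := (mdist z.1 z.2 `^ p)%:E.
have mf : measurable_fun setT f.
  by apply/measurable_EFinP; exact: measurable_mdist_powR.
pose F := [set z : borel (X * X)%type | ((e `^ p)%:E <= `|f z|)%E].
have mF : measurable F.
  rewrite -(setTI F); apply: emeasurable_fun_c_infty => //.
  exact: measurableT_comp.
have piF : (pi F <= e%:E)%E.
  have ep0 : 0 < e `^ p by exact: powR_gt0.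
  have := @le_integral_abse _ _ _ pi setT measurableT f (e `^ p) mf ep0.
  rewrite setTI -/F => h.
  rewrite -(@lee_pmul2l _ (e `^ p)%:E)// -EFinM; apply: (le_trans h).
  apply: ltW; apply: le_lt_trans cost_lt; rewrite /transport_cost.
  by under eq_integral do rewrite gee0_abs ?lee_fin ?powR_ge0//.
have mfat : measurable (fatten A e : set (borel X)).
  by apply: sub_sigma_algebra; exact: open_fatten.
have mT : measurable ((setT `*` fatten A e) : set (borel (X * X)%type)).
  by rewrite -(setTI (_ `*` _)) setTX; exact: measurable_snd_borel.
rewrite -pi1// -pi2//; apply: (@le_trans _ _ (pi ((setT `*` fatten A e) `|`
  F))).
  apply: le_measure; rewrite ?inE//.
  - by rewrite -(setTI (_ `*` _)) setXT; exact: measurable_fst_borel.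
  - exact: measurableU.
  - move=> [x y] /= [Ax _]; have [xye|exy] := ltP (mdist x y) e.
      by left; split => //; exists x.
    right; rewrite /F /f /= lee_fin ger0_norm ?powR_ge0//.
    by apply: ge0_ler_powR; rewrite ?nnegrE ?(ltW p0) ?(ltW e0) ?mdist_ge0.
apply: le_trans (measureU2 _ _ _) _ => //.
exact: leeD2l.
Qed.

Lemma cvg_fatten (mu : probability (borel X) R) (C : set X) : closed C ->
  mu (fatten C n.+1%:R^-1 : set (borel X)) @[n --> \oo] --> mu (C :
    set (borel X)).
Proof.
move=> cC.
have CE : C = \bigcap_n fatten C n.+1%:R^-1.
  apply/seteqP; split => [x Cx n _|y Cy].
    by exists x => //=; rewrite mdistxx invr_gt0.
  apply: cC => B /nbhs_ballP[e /= e0 eB].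
  have [N _ /(_ N)/(_ (leqnn _)) Ne] := near_infty_natSinv_lt (PosNum e0).
  have [x Cx /= xy] := Cy N Logic.I.
  exists x; split => //; apply: eB; rewrite ballEmdist/= metric_sym.
  exact: lt_trans Ne.
rewrite [in X in _ --> X]CE; apply: nonincreasing_cvg_mu.
- by rewrite ltey_eq fin_num_measure//; apply: sub_sigma_algebra;
  exact: open_fatten.
- by move=> n; apply: sub_sigma_algebra; exact: open_fatten.
- by apply: bigcapT_measurable => n; apply: sub_sigma_algebra;
  exact: open_fatten.
- move=> m n mn; apply/subsetPset => y [x Cx /= xy]; exists x => //=.
  by apply: lt_le_trans xy _; rewrite lef_pV2 ?posrE// ler_nat.
Qed.

(** Going through [la] fattens a closed set [C] twice by [e / 2], so the mass of [C] under one
    measure is at most that of [fatten C e] under the other, plus [e]. Letting [e] tend to 0 and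
    exchanging the roles gives equality on closed sets, hence on open sets, which form a generating
    pi-system. *)
Lemma optimal_cost_separated (mu nu : wasserstein p X) :
  (forall e, 0 < e -> exists la : probability (borel X) R,
    (optimal_cost mu la < e%:E)%E /\ (optimal_cost nu la < e%:E)%E) ->
  mu = nu.
Proof.
have closed_le (a b : probability (borel X) R) :
    (forall e, 0 < e -> exists la : probability (borel X) R,
      (optimal_cost a la < e%:E)%E /\ (optimal_cost b la < e%:E)%E) ->
    forall C : set X, closed C -> (a (C : set (borel X)) <= b C)%E.
  move=> ab C cC.
  have mC : measurable (C : set (borel X)).
    by rewrite -(setCK C); apply: measurableC; apply: sub_sigma_algebra;
      exact: closed_openC.
  have aCn n : (a C <= b (fatten C n.+1%:R^-1 :
    set (borel X)) + n.+1%:R^-1%:E)%E.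
    set e : R := n.+1%:R^-1.
    have e0 : 0 < e / 2 by rewrite divr_gt0// invr_gt0.
    have [|la [la1 la2]] := ab ((e / 2) `^ p * (e / 2)).
      by rewrite mulr_gt0// powR_gt0.
    rewrite optimal_cost_sym in la2.
    have mfat : measurable (fatten C (e / 2) : set (borel X)).
      by apply: sub_sigma_algebra; exact: open_fatten.
    apply: le_trans (optimal_cost_lt_fatten e0 la1 mC) _.
    apply: le_trans (leeD2r _ (optimal_cost_lt_fatten e0 la2 mfat)) _.
    rewrite -addeA -EFinD -splitr leeD2r//.
    apply: le_measure; rewrite ?inE//; try
      by apply: sub_sigma_algebra; exact: open_fatten.
    move=> z [y [x Cx /= xy] /= yz]; exists x => //=.
    by apply: le_lt_trans (metric_triangle x y z) _; rewrite [e]splitr ltrD.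
  have cvgb : (b (fatten C n.+1%:R^-1 : set (borel X)) + n.+1%:R^-1%:E)%E
      @[n --> \oo] --> b C.
    rewrite -[X in _ --> X]adde0; apply: cvgeD;
      [exact: fin_num_adde_defl|exact: cvg_fatten|].
    by apply: cvg_EFin; [exact: nearW|exact: cvg_harmonic].
  rewrite -(cvg_lim _ cvgb)//; apply: lime_ge; first by apply/cvg_ex; eexists;
    exact: cvgb.
  exact: nearW.
move=> munu; apply: wasserstein_ext => A mA.
apply: (@g_sigma_algebra_measure_unique _ R (borel X) (@open X) _ (fun=> setT))
  => //.
- by move=> U oU; exact: sub_sigma_algebra.
- by move=> _; exact: openT.
- by rewrite bigcup_const//; exists 0%N.
- by move=> U V; exact: openI.
- move=> U oU.
  have mU : measurable (U : set (borel X)) by exact: sub_sigma_algebra.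
  have : mu (~` U) = nu (~` U).
    apply/eqP; rewrite eq_le; apply/andP; split; apply: closed_le.
    + exact: munu.
    + exact: open_closedC.
    + by move=> e /munu[la [? ?]]; exists la.
    + exact: open_closedC.
  have mCU : measurable (~` U : set (borel X)) by exact: measurableC.
  move=> munuC; rewrite -(setCK U).
  apply: etrans (probability_setC mu mCU) _.
  apply: etrans (esym (probability_setC nu mCU)).
  by congr (1 - _)%E.
- by move=> n; rewrite ltey_eq fin_num_measure.
Qed.

End wasserstein_bounded.

(** * Geometry of the sphere *)

Section sphere_geometry.
Variables (R : realType) (n : nat).
Local Notation S := (sphere R n).
Implicit Types x y z : S.

Lemma mdist_angle x y : mdist x y = angle x y.
Proof. by []. Qed.

Lemma cos_mdist x y : cos (mdist x y) = dot (val x) (val y).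
Proof. exact: cos_angle. Qed.

Lemma mdist_le_pi x y : mdist x y <= pi.
Proof. by have /andP[] := angle_itv x y. Qed.

Lemma dotDl (u v w : 'rV[R]_n.+1) : dot (u + v) w = dot u w + dot v w.
Proof.
by rewrite /dot -big_split; apply: eq_bigr => i _; rewrite !mxE mulrDl.
Qed.

Lemma dotDr (u v w : 'rV[R]_n.+1) : dot w (u + v) = dot w u + dot w v.
Proof. by rewrite dotC dotDl !(dotC w). Qed.

Lemma dotNr (u v : 'rV[R]_n.+1) : dot u (- v) = - dot u v.
Proof. by rewrite -scaleN1r dotZr mulN1r. Qed.

Lemma dotNl (u v : 'rV[R]_n.+1) : dot (- u) v = - dot u v.
Proof. by rewrite dotC dotNr dotC. Qed.

Lemma dot_delta (u : 'rV[R]_n.+1) i : dot u (delta_mx 0 i) = u 0 i.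
Proof.
rewrite /dot (bigD1 i)//= mxE !eqxx mulr1 big1 ?addr0// => j /negPf ji.
by rewrite mxE eqxx ji mulr0.
Qed.

Lemma dot_normalized (u : 'rV[R]_n.+1) : dot u u = 1 -> enorm u == 1.
Proof. by rewrite /enorm => ->; rewrite sqrtr1. Qed.

Lemma antipode_subproof x : enorm (- val x) == 1.
Proof. by apply: dot_normalized; rewrite dotNl dotNr opprK sphere_dot1. Qed.

Definition antipode x : S := exist _ (- val x) (antipode_subproof x).

Lemma antipodeK : involutive antipode.
Proof. by move=> x; apply: val_inj; rewrite /= opprK. Qed.

Lemma mdist_antipode x y : mdist x (antipode y) = pi - mdist x y.
Proof. by rewrite !mdist_angle /angle /= dotNr acosN// sphere_dot_itv. Qed.

Lemma mdist_eq_pi x y : mdist x y = pi -> y = antipode x.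
Proof.
move=> xy; apply: mdist_positivity.
by rewrite mdist_antipode metric_sym xy subrr.
Qed.

Lemma antipode_neq x : antipode x <> x.
Proof.
move=> /(congr1 (fun y => mdist x y)); rewrite mdist_antipode mdistxx subr0.
by apply/eqP; rewrite gt_eqF// pi_gt0.
Qed.

Lemma sphere_coord_le1 x i : `|val x 0 i| <= 1.
Proof.
rewrite -(@ler_pXn2r _ 2)// ?nnegrE// expr1n real_normK ?num_real//.
apply: (@le_trans _ _ (dot (val x) (val x))); last by rewrite sphere_dot1.
rewrite /dot (bigD1 i)//= expr2 lerDl.
by apply: sumr_ge0 => j _; rewrite -expr2 sqr_ge0.
Qed.

(** The squared Euclidean chord. It links coordinates and angles in both directions: continuity of
    the coordinates, and small cells from close coordinates. *)
Lemma mdist_chord x y :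
  \sum_i (val x 0 i - val y 0 i) ^+ 2 = 2 * (1 - cos (mdist x y)).
Proof.
transitivity (dot (val x - val y) (val x - val y)).
  by apply: eq_bigr => i _; rewrite !mxE expr2.
rewrite cos_mdist dotBl !dotBr !sphere_dot1 (dotC (val y)); ring.
Qed.

Lemma continuous_sphere_coord i : continuous (fun x : S => val x 0 i).
Proof.
apply: (@mdist_continuous R S) => x e e0.
have e20 : 0 < e ^+ 2 / 2 by rewrite divr_gt0// exprn_gt0.
have := @continuous_cos R 0; rewrite /continuous_at cos0.
move=> /cvgrPdist_lt /(_ _ e20) /nbhs_ballP[d /= d0 dP].
exists d => // y xyd.
rewrite -(@ltr_pXn2r _ 2)// ?nnegrE ?(ltW e0)// real_normK ?num_real//.
apply: (@le_lt_trans _ _ (\sum_i (val x 0 i - val y 0 i) ^+ 2)).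
  by rewrite (bigD1 i)//= lerDl sumr_ge0// => j _; rewrite sqr_ge0.
rewrite mdist_chord -ltr_pdivlMl// mulrC.
apply: le_lt_trans (dP (mdist x y) _); first exact: ler_norm.
by rewrite /ball/= sub0r normrN ger0_norm// mdist_ge0.
Qed.

(** The interval [[-1, 1]] is cut into pieces of length [e], and the colour of [t] is the piece
    containing [f t]. The number of colours is fixed before [f], so that all coordinates of the
    sphere can share it. *)
Lemma measurable_fun_partition d (T : measurableType d) (e : R) : 0 < e ->
  exists k : nat, forall f : T -> R, measurable_fun setT f ->
    (forall t, `|f t| <= 1) -> exists c : T -> 'I_k,
    (forall i, measurable (c @^-1` [set i])) /\
    (forall t u, c t = c u -> `|f t - f u| <= e).
Proof.
move=> e0; pose k := Num.truncn (2 / e : R); exists k.+1 => f mf f1.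
pose g t := (f t + 1) / e.
have g0 t : 0 <= g t.
  by rewrite divr_ge0 ?(ltW e0)//; have := f1 t; rewrite ler_norml => /andP[];
    lra.
have gk t : (Num.truncn (g t) < k.+1)%N.
  rewrite ltnS; apply: le_truncn; rewrite ler_pM2r ?invr_gt0//.
  by have := f1 t; rewrite ler_norml => /andP[]; lra.
have mg : measurable_fun setT g.
  by apply: measurable_funM => //; exact: measurable_funD.
exists (fun t => Ordinal (gk t)); split => [i|t u [tu]].
  rewrite (_ : _ @^-1` _ = g @^-1` `[(i%:R), (i.+1%:R)[%classic).
    by rewrite -[X in measurable X]setTI; exact: mg.
  apply/seteqP; split => t /=; rewrite in_itv/=.
    by move=> <- /=; exact: truncn_itv.
  by move=> h; apply: val_inj => /=; apply/eqP; rewrite truncn_eq.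
have := truncn_itv (g0 t); have := truncn_itv (g0 u); rewrite -tu.
set m := Num.truncn _ => /andP[u1 u2] /andP[t1 t2].
have -> : f t - f u = e * (g t - g u) by rewrite /g; field; rewrite gt_eqF.
rewrite normrM (gtr0_norm e0) ler_piMr ?(ltW e0)// ler_norml.
by rewrite -(natr1 m) in u2 t2; apply/andP; split; lra.
Qed.

Lemma sphere_finely_partitionable : finely_partitionable S.
Proof.
move=> e e0.
(* Capping at [pi] keeps [d] in the interval where the cosine decreases. *)
pose d := Num.min e pi : R.
have d0 : 0 < d by rewrite lt_min e0 pi_gt0.
have dpi : d <= pi by rewrite ge_min lexx orbT.
have cd : 0 < 1 - cos d.
  rewrite subr_gt0 -cos0 ltr_cos// in_itv/= ?lexx ?(ltW d0) ?dpi//=.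
  by rewrite ltW// pi_gt0.
pose m : R := n.+1%:R.
have m0 : 0 < m by rewrite ltr0n.
(* If all [m] coordinates differ by at most [r <= 1], the squared chord is at most
   [m * r^2 <= m * r <= 1 - cos d], which is below the squared chord [2 * (1 - cos d)] of angle
   [d]. *)
pose r := Num.min 1 ((1 - cos d) / m).
have r0 : 0 < r by rewrite lt_min ltr01 divr_gt0.
have [k kP] := @measurable_fun_partition _ (borel S) r r0.
have /choice[c cP] : forall i : 'I_n.+1, exists c : borel S -> 'I_k,
    (forall j, measurable (c @^-1` [set j])) /\
    (forall t u, c t = c u -> `|val t 0 i - val u 0 i| <= r).
  move=> i; apply: kP; last by move=> t; exact: sphere_coord_le1.
  exact: (continuous_measurable_fun_real (@continuous_sphere_coord i)).
exists #|{ffun 'I_n.+1 -> 'I_k}|, (fun x => enum_rank [ffun i => c i x]).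
split => [j|x y /enum_rank_inj /ffunP cxy].
  rewrite (_ : _ @^-1` _ = \bigcap_(i in [set: 'I_n.+1]) c i @^-1` [set
    enum_val j i]).
    by apply: fin_bigcap_measurable => // i _; exact: (cP i).1.
  apply/seteqP; split => x /=.
    by move=> <- i _ /=; rewrite enum_rankK ffunE.
  move=> h; apply: enum_val_inj; rewrite enum_rankK; apply/ffunP => i.
  by rewrite ffunE h.
rewrite ltNge; apply/negP => exy.
have dxy : d <= mdist x y by rewrite ge_min exy.
have : 1 - cos d <= 1 - cos (mdist x y).
  rewrite lerB// leNgt ltr_cos ?in_itv/= ?mdist_ge0 ?mdist_le_pi ?(ltW d0)//.
  by rewrite -leNgt.
apply/negP; rewrite -ltNge.
have : 2 * (1 - cos (mdist x y)) <= m * r.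
  rewrite -mdist_chord; apply: (@le_trans _ _ (\sum_(i < n.+1) r)).
    apply: ler_sum => i _; have := (cP i).2 x y; have := cxy i; rewrite !ffunE.
    move=> -> /(_ erefl) h; rewrite -real_normK ?num_real//.
    apply: (@le_trans _ _ (1 * r)); last by rewrite mul1r.
    by rewrite expr2 ler_pM//; apply: le_trans h _; rewrite ge_min lexx.
  by rewrite sumr_const card_ord -mulr_natl.
have : m * r <= 1 - cos d.
  by rewrite mulrC -ler_pdivlMr// ge_min lexx orbT.
lra.
Qed.

(** Some coordinate of [x] is not of modulus 1, since otherwise the squared norm would be
    [n + 1 > 1]. The corresponding basis vector, projected orthogonally to [x] and normalized, is
    tangent. *)
Lemma exists_tangent x : (1 <= n)%N ->
  exists v : 'rV[R]_n.+1, dot v v = 1 /\ dot (val x) v = 0.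
Proof.
move=> n1.
have [i xi] : exists i, val x 0 i ^+ 2 != 1.
  apply: contrapT => /forallNP h.
  have x1 i : val x 0 i ^+ 2 = 1 by apply/eqP/negPn/negP/h.
  have := sphere_dot1 x; rewrite /dot (eq_bigr (fun=> 1)); last first.
    by move=> i _; rewrite -expr2 x1.
  rewrite sumr_const card_ord => /eqP; rewrite -[X in _ == X]mulr1n.
  by rewrite eqr_nat eqSS; case: (n) n1.
have xi1 : 0 < 1 - val x 0 i ^+ 2.
  rewrite subr_gt0 lt_neqAle xi -real_normK ?num_real//=.
  by rewrite expr_le1// sphere_coord_le1.
pose u : 'rV[R]_n.+1 := delta_mx 0 i - val x 0 i *: val x.
have dd : dot (delta_mx 0 i) (delta_mx 0 i : 'rV[R]_n.+1) = 1.
  by rewrite dot_delta mxE !eqxx.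
have uu : dot u u = 1 - val x 0 i ^+ 2.
  rewrite /u dotBl !dotBr !dotZl !dotZr dd sphere_dot1 (dotC _ (val x))
    !dot_delta.
  ring.
exists ((Num.sqrt (1 - val x 0 i ^+ 2))^-1 *: u); split.
  rewrite dotZl dotZr uu mulrA -invfM -expr2 sqr_sqrtr ?(ltW xi1)//.
  by rewrite mulVf// gt_eqF.
by rewrite dotZr /u dotBr dotZr dot_delta sphere_dot1 mulr1 subrr mulr0.
Qed.

(** The curve is [cos s x + sin s v] with [v] a unit tangent vector. The second clause presents
    [mdist z (g s)] as the arccosine of an explicit smooth function of [s]. *)
Lemma exists_great_circle x : (1 <= n)%N ->
  exists (g : R -> S) (v : 'rV[R]_n.+1),
    (forall s, `|s| <= pi -> mdist x (g s) = `|s|) /\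
    (forall s z, dot (val z) (val (g s)) =
       cos s * dot (val z) (val x) + sin s * dot (val z) v).
Proof.
move=> n1; have [v [vv xv]] := exists_tangent x n1.
have gP s : enorm (cos s *: val x + sin s *: v) == 1.
  apply: dot_normalized; rewrite dotDl !dotDr !dotZl !dotZr (dotC v) xv vv.
  by rewrite sphere_dot1 !mulr0 !mulr1 addr0 add0r -!expr2 cos2Dsin2.
exists (fun s => exist _ (cos s *: val x + sin s *: v) (gP s)), v.
have dotg s z : dot (val z) (cos s *: val x + sin s *: v) =
    cos s * dot (val z) (val x) + sin s * dot (val z) v.
  by rewrite dotDr !dotZr.
split => // s s_pi; rewrite mdist_angle /angle /= dotg sphere_dot1 xv mulr0
  addr0.
rewrite mulr1; have [s0|s0] := ger0P s.
  by rewrite cosK// in_itv/= s0; rewrite ger0_norm in s_pi.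
by rewrite -cosN cosK// in_itv/= oppr_ge0 (ltW s0)/=; rewrite ltr0_norm in s_pi.
Qed.

Lemma exists_near_notin x (e : R) (L : seq S) : (1 <= n)%N -> 0 < e ->
  exists z, mdist x z < e /\ z \notin L.
Proof.
move=> n1 e0; have [g [v [gP _]]] := exists_great_circle x n1.
pose d := Num.min e pi : R.
have d0 : 0 < d by rewrite lt_min e0 pi_gt0.
(* Denominators start at 2 to keep [s i] strictly below [d]; these are infinitely many distinct
   distances from [x], too many for the list [L]. *)
pose s (i : nat) : R := d / i.+2%:R.
have s0 i : 0 < s i by rewrite divr_gt0.
have sd i : s i < d by rewrite ltr_pdivrMr// ltr_pMr// ltr1n.
have gs i : mdist x (g (s i)) = s i.
  by rewrite gP gtr0_norm// ltW//; apply: lt_le_trans (sd i) _;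
    rewrite ge_min lexx orbT.
apply: contrapT => /forallNP h.
have gL i : g (s i) \in L.
  apply: contrapT => /negP gL; apply: (h (g (s i))); split => //.
  by rewrite gs; apply: lt_le_trans (sd i) _; rewrite ge_min lexx.
have : (size (mkseq (fun i => g (s i)) (size L).+1) <= size L)%N.
  apply: uniq_leq_size.
    rewrite mkseq_uniq// => i j /(congr1 (mdist x)); rewrite !gs.
    move=> /(mulfI (lt0r_neq0 d0)) /invr_inj /eqP.
    by rewrite eqr_nat => /eqP [].
  by move=> z /mapP[i _ ->].
by rewrite size_mkseq ltnn.
Qed.

(** The points are moved one at a time, each avoiding the finitely many antipodes of the points
    already placed. *)
Lemma exists_perturbation (I : finType) (q : I -> S) (e : R) :
  (1 <= n)%N -> 0 < e ->
  exists q' : I -> S, (forall i, mdist (q i) (q' i) < e) /\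
    (forall i j, q' i <> antipode (q' j)).
Proof.
move=> n1 e0.
suff [q' [q1 q2]] : exists q' : I -> S, (forall i, mdist (q i) (q' i) < e) /\
    (forall i j, i \in enum I -> j \in enum I -> q' i <> antipode (q' j)).
  by exists q'; split => // i' j'; apply: q2; rewrite mem_enum.
elim: (enum I) => [|i0 s [q' [q1 q2]]]; first by exists q; split=> // i;
  rewrite mdistxx.
have [z [qz zL]] := exists_near_notin (q i0) [seq antipode (q' j) | j <- s] n1
  e0.
exists (fun i => if i == i0 then z else q' i); split; first by move=> i;
  case: eqVneq => [->|].
move=> i j.
have zq k : k \in s -> z <> antipode (q' k).
  by move=> js zj; move/negP: zL; apply; rewrite zj; apply/mapP; exists k.
rewrite !inE; case: eqVneq => [_ _|_ /= is_]; case: eqVneq => [_ _|_ /= js].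
- by move=> /esym; exact: antipode_neq.
- exact: zq.
- by move=> /(congr1 antipode); rewrite antipodeK => /esym; exact: zq.
- exact: q2.
Qed.

End sphere_geometry.

(** * Second differences of powers of the distance *)

Section second_differences.
Variable R : realType.

Lemma powR_lipschitz (p M a b : R) : 1 <= p -> 0 <= a <= M -> 0 <= b <= M ->
  `|a `^ p - b `^ p| <= p * M `^ (p - 1) * `|a - b|.
Proof.
move=> p1; wlog ba : a b / b <= a => [wl aM bM|/andP[a0 aM] /andP[b0 bM]].
  have [|/ltW] := leP b a => h; first exact: wl.
  by rewrite distrC (distrC a); exact: wl.
have p0 : 0 < p by exact: lt_le_trans p1.
have powM x : 0 <= x -> x <= M -> x `^ (p - 1) <= M `^ (p - 1).
  by move=> x0 xM; apply: ge0_ler_powR => //; rewrite ?subr_ge0 ?nnegrE//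
    (le_trans x0).
rewrite !ger0_norm ?subr_ge0//; last by apply: ge0_ler_powR;
  rewrite ?nnegrE ?(ltW p0).
have [->|ab] := eqVneq a b; first by rewrite !subrr mulr0.
(* The mean value argument differentiates the power up to the endpoint [b], which must be positive;
   for [b = 0] the bound follows from [a^p = a * a^(p-1)] and [1 <= p]. *)
have [b00|bn0] := eqVneq b 0.
  rewrite b00 powR0 ?gt_eqF// !subr0 -(@mulr_powRB1 _ a p)// mulrC.
  apply: ler_wpM2r => //; apply: (@le_trans _ _ (1 * M `^ (p - 1))).
    by rewrite mul1r powM.
  by apply: ler_wpM2r => //; exact: powR_ge0.
have {}b0 : 0 < b by rewrite lt_neqAle eq_sym bn0.
have ltba : b < a by rewrite lt_neqAle eq_sym ab.
have [||c] := @MVT R (fun x => x `^ p) (fun x => p * x `^ (p - 1)) b a ltba.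
- by move=> x /[1!in_itv]/= /andP[bx _]; apply: is_derive1_powR;
  exact: lt_trans bx.
- apply: derivable_within_continuous => x /[1!in_itv]/= /andP[bx _].
  apply: (@ex_derive _ _ _ _ _ _ (p * x `^ (p - 1))).
  by apply: is_derive1_powR; exact: lt_le_trans bx.
rewrite in_itv/= => /andP[bc ca] ->; apply: ler_wpM2r;
  first by rewrite subr_ge0.
apply: ler_wpM2l; first exact: ltW.
by apply: powM; [exact: ltW (lt_trans b0 bc)|exact: le_trans (ltW ca) aM].
Qed.

Lemma is_derive_cvg_seq (f : R -> R) (a df : R) (u : nat -> R) :
  is_derive a 1 f df -> (forall k, u k != 0) -> u @ \oo --> 0 ->
  (f (a + u k) - f a) / u k @[k --> \oo] --> df.
Proof.
move=> [fa <-] u0 ucvg.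
have /cvgr_dnbhsP/(_ u (conj u0 ucvg)) :
    (fun h => h^-1 *: ((f \o shift a) (h *: 1) - f a)) @ 0^' --> 'D_1 f a.
  exact: fa.
apply: cvg_trans; apply: near_eq_cvg; apply: nearW => k /=.
by rewrite scaler1 [RHS]mulrC [u k + a]addrC.
Qed.

(** The division is by the step and not by its square, so the limit is the jump of the first
    derivative at 0. The steps form a sequence, ready for dominated convergence. *)
Definition second_difference (f : R -> R) (k : nat) : R :=
  (f k.+1%:R^-1 + f (- k.+1%:R^-1) - 2 * f 0) / k.+1%:R^-1.

(** Here [f'] is not a derivative of [f] but a differentiable function with [f s = f' |s|] at the
    points used; each side contributes the slope [df]. *)
Lemma second_difference_even (f f' : R -> R) (df : R) :
  is_derive (0 : R) 1 f' df -> (forall k, f k.+1%:R^-1 = f' k.+1%:R^-1) ->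
  (forall k, f (- k.+1%:R^-1) = f' k.+1%:R^-1) -> f 0 = f' 0 ->
  second_difference f @ \oo --> 2 * df.
Proof.
move=> f'D f1 f2 f0.
have h0 k : k.+1%:R^-1 != 0 :> R by rewrite invr_eq0 pnatr_eq0.
have : 2 * ((f' (0 + k.+1%:R^-1) - f' 0) / k.+1%:R^-1) @[k --> \oo] --> 2 * df.
  by apply: cvgMl_tmp; exact: is_derive_cvg_seq f'D h0 (@cvg_harmonic R).
apply: cvg_trans; apply: near_eq_cvg; apply: nearW => k.
by rewrite /second_difference f1 f2 f0 add0r; ring.
Qed.

(** The difference quotients from the right and from the left have the same limit and cancel. *)
Lemma second_difference_derive (f : R -> R) (df : R) :
  is_derive (0 : R) 1 f df -> second_difference f @ \oo --> 0.
Proof.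
move=> fD.
have h0 k : k.+1%:R^-1 != 0 :> R by rewrite invr_eq0 pnatr_eq0.
have hN0 k : - k.+1%:R^-1 != 0 :> R by rewrite oppr_eq0.
have hNcvg : - k.+1%:R^-1 @[k --> \oo] --> (0 : R).
  by rewrite -oppr0; apply: cvgN; exact: cvg_harmonic.
have : (f (0 + k.+1%:R^-1) - f 0) / k.+1%:R^-1 -
    (f (0 - k.+1%:R^-1) - f 0) / - k.+1%:R^-1 @[k --> \oo] --> df - df.
  apply: cvgB; first exact: is_derive_cvg_seq fD h0 (@cvg_harmonic R).
  exact: (is_derive_cvg_seq fD hN0 hNcvg).
rewrite subrr; apply: cvg_trans; apply: near_eq_cvg; apply: nearW => k /=.
rewrite /second_difference !add0r; move: (h0 k); move: k.+1%:R^-1 => x x0.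
by field.
Qed.

End second_differences.

Section second_differences_on_the_sphere.
Variables (R : realType) (n : nat) (p : R).
Hypotheses (n1 : (1 <= n)%N) (p1 : 1 <= p).
Local Notation S := (sphere R n).
Implicit Types y z : S.

Let p0 : 0 < p. Proof. exact: lt_le_trans ltr01 p1. Qed.

Let h (k : nat) : R := k.+1%:R^-1.

Let h_gt0 k : 0 < h k. Proof. by rewrite invr_gt0. Qed.

Let h_le_pi k : h k <= pi.
Proof.
apply: le_trans (_ : 1 <= pi); first by rewrite invf_le1// ler1n.
by apply: le_trans (pi_ge2 _); rewrite ler1n.
Qed.

(** The limit of [2 * h^(p-1)] as the step [h] tends to 0, that is, the corner of [|s|^p] at 0. *)
Definition kink_antipodal : R := if p == 1 then 2 else 0.

Definition kink y z : R :=
  - (2 * (p * pi `^ (p - 1))) * \1_[set y] z +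
  kink_antipodal * \1_[set antipode y] z.

(* Along a great circle through the antipode of y, the function mdist z _ ^ p is
   differentiable there unless z is y or, when p = 1, the antipode of y. *)
Lemma cvg_second_difference_mdist y : exists g : R -> S,
  [/\ forall z, second_difference (fun s => mdist z (g s) `^ p) @ \oo --> kink
    y z &
      forall z k, `|second_difference (fun s => mdist z (g s) `^ p) k| <=
        2 * (p * pi `^ (p - 1))].
Proof.
have [g [v [gP dotg]]] := exists_great_circle (antipode y) n1.
have gN s : `|s| <= pi -> mdist y (g s) = pi - `|s|.
  move=> s_pi; rewrite metric_sym -(antipodeK y) mdist_antipode metric_sym gP//.
have g0 : g 0 = antipode y.
  by apply/esym/mdist_positivity; rewrite gP ?normr0// pi_ge0.
exists g; split=> [z|z k]; last first.
  (* The uniform bound needed for dominated convergence: [t^p] is Lipschitz on [[0, pi]] with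
     constant [p * pi^(p-1)], and [g s] is at distance [|s|] from [g 0]. The two increments give the
     factor 2. *)
  have lip s : `|s| <= pi ->
      `|mdist z (g s) `^ p - mdist z (g 0) `^ p| <= p * pi `^ (p - 1) * `|s|.
    move=> s_pi; apply: le_trans (powR_lipschitz p1 (M := pi) _ _) _;
      rewrite ?mdist_ge0 ?mdist_le_pi//.
    apply: ler_wpM2l; first by rewrite mulr_ge0 ?powR_ge0// ltW.
    apply: le_trans (mdist_lipschitz z (g s) z (g 0)) _.
    by rewrite mdistxx add0r g0 metric_sym gP.
  have hk : `|h k| <= pi by rewrite gtr0_norm.
  have hNk : `|- h k| <= pi by rewrite normrN.
  rewrite /second_difference -/(h k) normrM normfV (gtr0_norm (h_gt0 k)).
  rewrite ler_pdivrMr//.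
  have -> : mdist z (g (h k)) `^ p + mdist z (g (- h k)) `^ p -
      2 * mdist z (g 0) `^ p =
    (mdist z (g (h k)) `^ p - mdist z (g 0) `^ p) +
    (mdist z (g (- h k)) `^ p - mdist z (g 0) `^ p) by ring.
  apply: le_trans (ler_normD _ _) _.
  apply: le_trans (lerD (lip _ hk) (lip _ hNk)) _.
  by rewrite normrN (gtr0_norm (h_gt0 k)); lra.
have hk k : `|h k| <= pi by rewrite gtr0_norm.
have hNk k : `|- h k| <= pi by rewrite normrN.
(* For [z = y] the function of [s] is [(pi - |s|)^p]; for [z] antipodal to [y], treated next, it is
   [|s|^p]. *)
have [->|zy] := eqVneq z y.
  have -> : kink y y = 2 * (- (p * pi `^ (p - 1))).
    rewrite /kink !indicE mem_set// memNset/=; last exact/nesym/antipode_neq.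
    by rewrite mulr1 mulr0 addr0 mulrN.
  apply: (@second_difference_even _ _ (fun s => (pi - s) `^ p)).
  - have D1 : is_derive (0 : R) 1 (fun s : R => pi - s) (- 1).
      rewrite -[X in is_derive _ _ _ X]sub0r.
      exact: (@is_deriveB _ _ _ (cst pi) id).
    have D2 : is_derive (pi - 0 : R) 1 (fun x => x `^ p) (p * (pi - 0) `^ (p -
      1)).
      by apply: is_derive1_powR; rewrite subr0 pi_gt0.
    have := @is_derive1_comp _ (fun x => x `^ p) (fun s => pi - s) _ _ _ D2 D1.
    by rewrite subr0 mulrN1.
  - by move=> k; rewrite (gN _ (hk k)) gtr0_norm.
  - by move=> k; rewrite (gN _ (hNk k)) normrN gtr0_norm.
  - by rewrite gN ?normr0// pi_ge0.
have [->|zNy] := eqVneq z (antipode y).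
  have -> : kink y (antipode y) = kink_antipodal.
    rewrite /kink !indicE memNset/=; last exact: antipode_neq.
    by rewrite mem_set// mulr0 add0r mulr1.
  have E k : second_difference (fun s => mdist (antipode y) (g s) `^ p) k =
      2 * h k `^ (p - 1).
    rewrite /second_difference -/(h k) (gP _ (hk k)) (gP _ (hNk k)) gP ?normr0
      ?pi_ge0// normrN.
    rewrite (gtr0_norm (h_gt0 k)) powR0 ?gt_eqF// mulr0 subr0.
    rewrite -(@mulr_powRB1 _ (h k) p) ?(ltW (h_gt0 k))//; field.
    by rewrite gt_eqF.
  rewrite (_ : second_difference _ = fun k => 2 * h k `^ (p - 1));
    last exact/funext.
  rewrite /kink_antipodal; case: eqVneq => [->|pN1].
    by under eq_fun do rewrite subrr powRr0 mulr1; exact: cvg_cst.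
  rewrite -[X in _ --> X](mulr0 2); apply: cvgMl_tmp.
  have p10 : 0 < p - 1 by rewrite subr_gt0 lt_neqAle eq_sym pN1.
  have /cvg_at_rightP/(_ h) := @powR_cvg0 R (p - 1) p10.
  by apply; split => //; exact: cvg_harmonic.
have -> : kink y z = 0.
  rewrite /kink !indicE !memNset/= ?mulr0 ?addr0//; first exact/eqP.
  exact/eqP.
(* In the remaining case [-1 < a < 1], so the arccosine is differentiable at [a] and its value is
   positive, where the power is differentiable too. *)
set a := dot (val z) (val (antipode y)); set b := dot (val z) v.
have aitv : -1 < a < 1.
  have /andP[a1 a2] := sphere_dot_itv z (antipode y).
  rewrite !lt_neqAle a1 a2 !andbT; apply/andP; split; apply/eqP => aE.
    move/eqP: zy; apply; rewrite -(antipodeK z) -(antipodeK y); congr antipode.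
    apply/esym/mdist_eq_pi.
    by rewrite mdist_angle /angle -/a -aE acosN1.
  move/eqP: zNy; apply; apply: mdist_positivity.
  by rewrite mdist_angle /angle -/a aE acos1.
have mE s : mdist z (g s) = acos (cos s * a + sin s * b).
  by rewrite mdist_angle /angle dotg.
have D0 : is_derive (0 : R) 1 (fun s : R => cos s * a + sin s * b) b.
  rewrite [X in is_derive _ _ _ X](_ : _ = a *: (- sin 0) + b *: cos 0);
    last first.
    by rewrite sin0 cos0 oppr0 scaler0 add0r /GRing.scale/= mulr1.
  rewrite (_ : (fun s => _) = a \*: @cos R + b \*: @sin R); last first.
    by apply/funext => s; transitivity (a * cos s + b * sin s) => //; ring.
  exact: is_deriveD.
have c0 : cos 0 * a + sin 0 * b = a by rewrite cos0 sin0 mul1r mul0r addr0.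
have Da : is_derive (cos 0 * a + sin 0 * b) 1 (@acos R) (- (Num.sqrt (1 - a ^+
  2))^-1).
  by rewrite c0; exact: is_derive1_acos.
pose u (s : R) := cos s * a + sin s * b.
have Dac := @is_derive1_comp _ (@acos R) u _ _ _ Da D0.
have Dp : is_derive ((@acos R \o u) 0) 1
    (fun x => x `^ p) (p * acos a `^ (p - 1)).
  rewrite /= /u c0; apply: is_derive1_powR; apply: acos_gt0.
  by have /andP[/ltW -> ->] := aitv.
have := second_difference_derive (@is_derive1_comp _ (fun x => x `^ p) (@acos R
  \o u) _ _ _ Dp Dac).
rewrite (_ : (_ \o _) = fun s => mdist z (g s) `^ p)//.
by apply/funext => s /=; rewrite mE.
Qed.

End second_differences_on_the_sphere.

(** * Potentials *)

Section potentials.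
Variables (R : realType) (n : nat) (p : R).
Hypotheses (n1 : (1 <= n)%N) (p1 : 1 <= p).
Local Notation S := (sphere R n).
Implicit Types (x y z : S) (mu nu : probability (borel S) R).

Let p0 : 0 < p. Proof. exact: lt_le_trans ltr01 p1. Qed.

Lemma integrable_mdist_powR mu x :
  mu.-integrable setT (fun z : borel S => (mdist z x `^ p)%:E).
Proof.
apply: (@measurable_bounded_integrable _ _ _ mu (fun z :
  borel S => mdist z x `^ p)).
- exact: measurableT.
- by rewrite ltey_eq fin_num_measure.
- exact: (@measurable_mdistl_powR R S).
- exists (pi `^ p); split; first exact: num_real.
  move=> M piM z _ /=; rewrite ger0_norm ?powR_ge0//; apply: le_trans (ltW piM).
  by apply: ge0_ler_powR; rewrite ?nnegrE ?(ltW p0) ?mdist_ge0 ?pi_ge0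
    ?mdist_le_pi.
Qed.

Definition same_potential mu nu : Prop := forall x,
  (\int[mu]_z (mdist (z : S) x `^ p)%:E = \int[nu]_z (mdist (z :
    S) x `^ p)%:E)%E.

(** The right-hand side involves [mu] only through three values of its potential. *)
Lemma integral_second_difference mu (g : R -> S) k :
  (\int[mu]_z (second_difference (fun s => mdist (z : S) (g s) `^ p) k)%:E =
   (k.+1%:R^-1)^-1%:E * \int[mu]_z (mdist (z : S) (g k.+1%:R^-1) `^ p)%:E +
   (k.+1%:R^-1)^-1%:E * \int[mu]_z (mdist (z : S) (g (- k.+1%:R^-1)) `^ p)%:E +
   (- 2 / k.+1%:R^-1)%:E * \int[mu]_z (mdist (z : S) (g 0) `^ p)%:E)%E.
Proof.
rewrite -!integralZl//; try exact: integrable_mdist_powR.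
rewrite -!integralD//; try
  (do ?apply: integrableD => //; apply: integrableZl => //;
    exact: integrable_mdist_powR).
apply: eq_integral => z _; rewrite -!EFinM -!EFinD; congr EFin.
by rewrite /second_difference; ring.
Qed.

Lemma integral_kink mu y : (\int[mu]_z (kink p y z)%:E =
  (- (2 * (p * pi `^ (p - 1))))%:E * mu [set y] +
  (kink_antipodal p)%:E * mu [set antipode y])%E.
Proof.
have mS := @measurable_borel_set1 R S.
have iS w : mu.-integrable setT (fun z : borel S => (\1_[set w] z)%:E).
  by apply: integrable_indic; exact: mS.
have indE w : (\int[mu]_z (\1_[set w] z)%:E = mu [set w])%E.
  by rewrite integral_indic ?setIT//; exact: mS.
rewrite -!indE -!integralZl//.
by rewrite -integralD//; apply: integrableZl.
Qed.

(** In the limit, with [A = 2 p pi^(p-1) > 0] and [c = kink_antipodal p >= 0], one gets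
    [A mu{y} = A nu{y} - c nu{-y}], whose right-hand side is at most [A nu{y}]. *)
Lemma same_potential_atom mu nu y : same_potential mu nu ->
  mu [set antipode y] = 0%E -> (mu [set y] <= nu [set y])%E.
Proof.
move=> munu muNy.
have [g [gcvg gle]] := cvg_second_difference_mdist n1 p1 y.
pose G k (z : borel S) : R := second_difference (fun s => mdist z (g s) `^ p) k.
have mG k : measurable_fun setT (G k).
  apply: measurable_funM => //; apply: measurable_funB.
    by apply: measurable_funD; exact: (@measurable_mdistl_powR R S).
  by apply: measurable_funM => //; exact: (@measurable_mdistl_powR R S).
have mK : measurable_fun setT (kink p y : borel S -> R).
  by apply: (measurable_fun_cvg mG) => z _; exact: gcvg.
have lim (m : probability (borel S) R) : (\int[m]_z (G k z)%:E @[k --> \oo] -->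
  \int[m]_z (kink p y z)%:E)%E.
  have [] // := @dominated_convergence _ (borel S) R m setT measurableT
    (fun k z => (G k z)%:E) (fun z => (kink p y z)%:E)
    (cst (2 * (p * pi `^ (p - 1)))%:E).
  - by move=> k; apply/measurable_EFinP.
  - exact/measurable_EFinP.
  - apply: aeW => z _; apply: cvg_EFin; first exact: nearW.
    exact: gcvg.
  - exact: finite_measure_integrable_cst.
  - apply: aeW => z k _; rewrite lee_fin; exact: gle.
have : (\int[mu]_z (kink p y z)%:E = \int[nu]_z (kink p y z)%:E)%E.
  apply: (cvg_unique _ (lim mu)) => //.
  rewrite (_ : (fun k => _) = fun k => (\int[nu]_z (G k z)%:E)%E);
    first exact: lim.
  by apply/funext => k; rewrite !integral_second_difference !munu.
rewrite !integral_kink muNy mule0 adde0.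
have mS := @measurable_borel_set1 R S.
rewrite -[mu _]fineK ?fin_num_measure//; try exact: mS.
rewrite -[nu [set y]]fineK ?fin_num_measure//; try exact: mS.
rewrite -[nu [set antipode y]]fineK ?fin_num_measure//; try exact: mS.
have nuNy : 0 <= fine (nu [set antipode y]) by exact: fine_ge0.
rewrite -!EFinM -EFinD lee_fin => -[].
set A := 2 * _; set a := fine _; set b := fine _ => E.
have A0 : 0 < A by rewrite !mulr_gt0// powR_gt0// pi_gt0.
have c0 : 0 <= kink_antipodal p by rewrite /kink_antipodal; case: ifP.
rewrite -(@ler_pM2l _ A)//.
have : 0 <= kink_antipodal p * fine (nu [set antipode y]) by exact: mulr_ge0.
lra.
Qed.

(** The antipode of an atom of [mu] lies outside its support, so [mu <= nu] at each point of the
    support, hence on all Borel sets; equal total mass gives equality. The support of [nu] is left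
    free. *)
Lemma same_potential_eq (I : finType) (q : I -> S) mu nu :
  (forall i j, q i <> antipode (q j)) -> mu (range q) = 1%E ->
  same_potential mu nu -> forall A, measurable A -> mu A = nu A.
Proof.
move=> qP muq munu; apply: probability_eq_of_le => A mA.
have finq : finite_set (range q) by apply: finite_image; exact: finite_finset.
have mS := @measurable_borel_set1 R S.
have mF (B : set (borel S)) : B `<=` range q -> measurable B.
  by move=> Bq; apply: finite_borel_measurable; exact: sub_finite_set finq.
have muqC : mu (~` range q) = 0%E by apply/probability_eq1 => //; exact: mF.
have fAq : finite_set (A `&` range q) by exact: sub_finite_set (@subIsetr _ _
  _) finq.
have sumE (m : probability (borel S) R) :
    (m (A `&` range q) = \sum_(z \in A `&` range q) m [set z])%E.
  rewrite -[in LHS](image_id (A `&` range q)) -bigcup_imset1.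
  by rewrite (measure_fin_bigcup m fAq)// => i j _ _ [z [-> ->]].
apply: (@le_trans _ _ (mu (A `&` range q))).
  rewrite (measureDI mu mA (mF _ (@subset_refl _ _))).
  rewrite (subset_measure0 _ _ _ muqC) ?add0e//.
  - exact: measurableD (mF _ _).
  - by apply: measurableC; exact: mF.
apply: (@le_trans _ _ (nu (A `&` range q))); last first.
  by apply: le_measure; rewrite ?inE//; apply: mF; exact: subIsetr.
rewrite !sumE; apply: lee_fsum => // _ [_ [i _ <-]].
apply: same_potential_atom => //; apply: (subset_measure0 _ _ _ muqC).
- exact: mS.
- by apply: measurableC; exact: mF.
- by move=> _ -> [j _] /qP.
Qed.

End potentials.

(** * Isometries *)

Section isometries.
Variables (R : realType) (n : nat) (p : R).
Hypotheses (n1 : (1 <= n)%N) (p1 : 1 <= p).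
Local Notation S := (sphere R n).
Local Notation W := (wasserstein p S).
Implicit Types (x y z : S) (mu nu la : W).

Let p0 : 0 < p. Proof. exact: lt_le_trans ltr01 p1. Qed.
Let mpi := @mdist_le_pi R n.
Let fpS := @sphere_finely_partitionable R n.
Let mS := @measurable_borel_set1 R S.

Lemma exists_pushforward mu (f : borel S -> borel S) : measurable_fun setT f ->
  exists nu, forall A, measurable A -> nu A = mu (f @^-1` A).
Proof.
move=> mf; have [Q QE] := pushforward_probability mu mf.
have [nu nuQ] := wasserstein_of_probability p1 mpi Q.
by exists nu => A mA; rewrite nuQ// QE.
Qed.

Lemma exists_dirac x : exists mu, mu [set x] = 1%E.
Proof.
have [mu muE] := wasserstein_of_probability p1 mpi (@dirac _ (borel S) x R).
exists mu; apply: etrans (muE _ (mS x)) _.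
by apply: etrans (@diracE _ (borel S) R x [set x]) _; rewrite mem_set.
Qed.

Lemma optimal_cost_diracs mu nu x y : mu [set x] = 1%E -> nu [set y] = 1%E ->
  optimal_cost p mu nu = (mdist x y `^ p)%:E.
Proof.
move=> mux nuy; rewrite (optimal_cost_dirac p fpS mu nuy).
transitivity (\int[mu]_z (cst (mdist x y `^ p)%:E z))%E; last first.
  by rewrite integral_cst//= probability_setT mule1.
apply: ae_eq_integral => //.
- by apply/measurable_EFinP; exact: (@measurable_mdistl_powR R S).
- exists (~` [set x]); split.
  + by apply: measurableC; exact: mS.
  + by apply/probability_eq1 => //; exact: mS.
  + by move=> z /= h zx; apply: h => _; rewrite zx.
Qed.

Section distance_preserving.
Variable Phi : W -> W.
Hypothesis PhiE : forall mu nu,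
  wasserstein_dist (Phi mu) (Phi nu) = wasserstein_dist mu nu.

Lemma isometry_optimal_cost mu nu :
  optimal_cost p (Phi mu) (Phi nu) = optimal_cost p mu nu.
Proof. exact/(optimal_cost_eq p1). Qed.

Lemma isometry_dirac mu x : mu [set x] = 1%E -> exists y, Phi mu [set y] = 1%E.
Proof.
move=> mux; have [nu nux] := exists_dirac (antipode x).
have := optimal_cost_diracs nux mux.
rewrite -isometry_optimal_cost metric_sym mdist_antipode mdistxx subr0.
move=> /(optimal_cost_diameter p1 mpi fpS (pi_ge0 R))[z zP].
exists (antipode z); apply: zP; first exact: mS.
by move=> y /= /mdist_eq_pi.
Qed.

End distance_preserving.

(** The inverse [Psi] preserves distances as well, and the map [psi'] that it induces on points is
    the inverse of [psi]. The cost between Dirac measures is the [p]-th power of the distance of the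
    points, so [psi] preserves distances. *)
Lemma exists_isometry_of_diracs (Phi : W -> W) :
  is_isometry (@wasserstein_dist R p S) Phi ->
  exists2 psi : S -> S, is_isometry (@mdist R S) psi &
    forall mu x, mu [set x] = 1%E -> Phi mu [set psi x] = 1%E.
Proof.
move=> [[Psi PhiK PsiK] PhiE].
have PsiE mu nu : wasserstein_dist (Psi mu) (Psi nu) = wasserstein_dist mu nu.
  by rewrite -PhiE !PsiK.
have /choice[d dE] := exists_dirac.
have /choice[psi psiE] : forall x, exists y, Phi (d x) [set y] = 1%E.
  by move=> x; exact: isometry_dirac PhiE _ _ (dE x).
have /choice[psi' psi'E] : forall x, exists y, Psi (d x) [set y] = 1%E.
  by move=> x; exact: isometry_dirac PsiE _ _ (dE x).
have uniq mu x y : mu [set x] = 1%E -> mu [set y] = 1%E -> x = y.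
  move=> mux muy; apply: mdist_positivity.
  have := optimal_cost_diracs mux muy.
  rewrite (optimal_cost_diracs mux mux) mdistxx powR0 ?gt_eqF// => -[] /esym.
  by move=> /powR_eq0_eq0.
have deq mu x : mu [set x] = 1%E -> mu = d x.
  move=> mux; apply: (optimal_cost_separated p1 fpS) => e e0; exists (d x).
  by rewrite (optimal_cost_diracs mux (dE x)) (optimal_cost_diracs (dE x) (dE
    x))
    mdistxx powR0 ?gt_eqF.
have PhidE x : Phi (d x) = d (psi x) by apply: deq; exact: psiE.
have PsidE x : Psi (d x) = d (psi' x) by apply: deq; exact: psi'E.
exists psi; last by move=> mu x /deq ->; exact: psiE.
split.
  exists psi' => x.
    by apply: (uniq (d x)) => //; rewrite -(PhiK (d x)) PhidE; exact: psi'E.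
  by apply: (uniq (d x)) => //; rewrite -(PsiK (d x)) PsidE; exact: psiE.
move=> x y; apply: (powR_injective p0); rewrite ?nnegrE ?mdist_ge0//.
have := isometry_optimal_cost PhiE (d x) (d y).
by rewrite (optimal_cost_diracs (psiE x) (psiE y)) (optimal_cost_diracs (dE x)
  (dE y)) => -[].
Qed.

Lemma isometry_antipode (psi : S -> S) y : is_isometry (@mdist R S) psi ->
  psi (antipode y) = antipode (psi y).
Proof.
move=> [_ psiE]; apply: mdist_eq_pi.
by rewrite psiE mdist_antipode mdistxx subr0.
Qed.

Lemma optimal_cost_pushforward_lt d (T : measurableType d) (P : probability T R)
    (f g : T -> borel S) (mu nu : probability (borel S) R) (e : R) :
  measurable_fun setT f -> measurable_fun setT g ->
  (forall A, measurable A -> mu A = P (f @^-1` A)) ->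
  (forall A, measurable A -> nu A = P (g @^-1` A)) ->
  0 < e -> (forall t, mdist (f t : S) (g t) < e) ->
  (optimal_cost p mu nu <= (e `^ p)%:E)%E.
Proof.
move=> mf mg muE nuE e0 fg.
have [pi cpi piE] := coupling_of_pair p fpS mf mg muE nuE.
apply: le_trans (optimal_cost_le p cpi) _; rewrite piE.
apply: (@le_trans _ _ (\int[P]_t (cst (e `^ p)%:E t))%E); last first.
  by rewrite integral_cst//= probability_setT mule1.
apply: ge0_le_integral => //.
- by move=> t _; rewrite lee_fin powR_ge0.
- apply/measurable_EFinP.
  have := measurable_fun_borel_pair fpS mf mg.
  exact: (measurableT_comp (@measurable_mdist_powR R S p)).
- move=> t _; rewrite lee_fin.
  by apply: ge0_ler_powR; rewrite ?nnegrE ?(ltW p0) ?(ltW e0) ?mdist_ge0// ltW.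
Qed.

(** Here [la] is the discretization of [mu] along [q \o c], and [la'] its image under [psi]. Their
    potentials are compared by writing each point as [psi (psi' x)], the location of the image under
    [Phi] of a Dirac measure. *)
Lemma isometry_of_finite_support (Phi : W -> W) (psi : S -> S)
    (I : finType) (q : I -> S) (c : borel S -> I) (mu la la' : W) :
  is_isometry (@wasserstein_dist R p S) Phi ->
  is_isometry (@mdist R S) psi ->
  (forall nu x, nu [set x] = 1%E -> Phi nu [set psi x] = 1%E) ->
  (forall i j, q i <> antipode (q j)) ->
  measurable_fun setT (q \o c : borel S -> borel S) ->
  (forall A, measurable A -> la A = mu ((q \o c) @^-1` A)) ->
  (forall A, measurable A -> la' A = mu ((psi \o q \o c) @^-1` A)) ->
  Phi la = la'.
Proof.
move=> [_ PhiE] ipsi Phidirac qP mqc laE la'E.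
have [[psi' psiK psi'K] psiE] := ipsi.
have mpsi : measurable_fun setT (psi : borel S -> borel S).
  by apply: continuous_measurable_fun_borel; exact: isometry_continuous.
have pushE (m : probability (borel S) R) (f : borel S -> borel S) x :
    measurable_fun setT f -> (forall A, measurable A -> m A = mu (f @^-1` A)) ->
    (\int[m]_z (mdist (z : S) x `^ p)%:E = \int[mu]_z (mdist (f z :
      S) x `^ p)%:E)%E.
  move=> mf mE; have [Q QE] := pushforward_probability mu mf.
  transitivity (\int[Q]_z (mdist (z : S) x `^ p)%:E)%E.
    apply: eq_measure_integral => A mA _; transitivity (m A); first by [].
    rewrite mE//; transitivity (Q A); [by rewrite QE|by []].
  rewrite QE ge0_integral_pushforward//.
  - by apply/measurable_EFinP; exact: (@measurable_mdistl_powR R S).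
  - by move=> z _; rewrite lee_fin powR_ge0.
(* The sides are exchanged because [la'] is the measure whose support is known; of [Phi la] only the
   potential is. *)
apply/esym/wasserstein_ext => A mA.
apply: (@same_potential_eq _ _ _ n1 p1 I (psi \o q)) mA.
- move=> i j /=; rewrite -isometry_antipode// => /(can_inj psiK).
  exact: qP.
- have mq : measurable (range (psi \o q) : set (borel S)).
    by apply: finite_borel_measurable; apply: finite_image;
      exact: finite_finset.
  apply: etrans (la'E _ mq) _; rewrite -[RHS](probability_setT mu);
    congr (mu _).
  by apply/seteqP; split => // t _ /=; exists (c t).
- move=> x; rewrite -(psi'K x).
  have [nu nux] := exists_dirac (psi' x).
  rewrite (pushE la' _ _ (measurableT_comp mpsi mqc) la'E).
  transitivity (optimal_cost p (Phi la) (Phi nu)).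
    rewrite (isometry_optimal_cost PhiE) (optimal_cost_dirac p fpS _ nux).
    rewrite (pushE la _ _ mqc laE).
    by apply: eq_integral => z _ /=; rewrite psiE.
  by rewrite (optimal_cost_dirac p fpS _ (Phidirac _ _ nux)).
Qed.

End isometries.

(** * Approximation by finitely supported measures, and rigidity *)

Theorem theorem4p2 (R : realType) (n : nat) (p : R) (hn : (1 <= n)%N)
  (hp : 1 <= p) : isometrically_rigid p (sphere R n).
Proof.
move=> Phi iPhi; have [psi ipsi Phidirac] := exists_isometry_of_diracs hp iPhi.
exists psi => // mu A mA.
have psiE := ipsi.2.
have mpsi : measurable_fun setT (psi : borel (sphere R n) ->
  borel (sphere R n)).
  by apply: continuous_measurable_fun_borel; exact: isometry_continuous.
have [nu nuE] := exists_pushforward hp mu mpsi.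
suff -> : Phi mu = nu by exact: nuE.
have fpS := @sphere_finely_partitionable R n.
apply: (optimal_cost_separated hp fpS) => e e0.
have p0 : 0 < p by exact: lt_le_trans hp.
(* Moving every point by less than [r] costs at most [r^p = e / 2], which is strictly below [e]. One
   half of [r] is spent on reaching a representative of the cell, the other on removing antipodal
   pairs. *)
pose r := (e / 2) `^ p^-1.
have e20 : 0 < e / 2 by rewrite divr_gt0.
have r0 : 0 < r by exact: powR_gt0.
have r20 : 0 < r / 2 by rewrite divr_gt0.
have rp : ((r `^ p)%:E < e%:E)%E.
  rewrite lte_fin /r -powRrM mulVf ?gt_eqF// powRr1 ?(ltW e20)//.
  by rewrite ltr_pdivrMr// ltr_pMr// ltr1n.
have [k [c [mc cP]]] := fpS _ r20.
have [q0 q0P] : exists q0 : 'I_k -> sphere R n, forall t,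
  mdist t (q0 (c t)) < r / 2.
  have /choice[q0 q0P] : forall i, exists x, forall t, c t = i ->
    mdist t x < r / 2.
    move=> i; have [[x cx]|nx] := pselect (exists x, c x = i).
      by exists x => t ct; apply: cP; rewrite ct cx.
    (* An empty cell receives a default representative. *)
    by exists point => t ct; exfalso; apply: nx; exists t.
  by exists q0 => t; exact: q0P.
have [q [qq0 qP]] := exists_perturbation q0 hn r20.
have tq t : mdist t (q (c t)) < r.
  apply: le_lt_trans (metric_triangle t (q0 (c t)) _) _.
  by rewrite [r]splitr ltrD.
have mqc : measurable_fun setT (q \o c : borel (sphere R n) ->
  borel (sphere R n)).
  move=> _ B mB; rewrite setTI.
  rewrite (_ : _ @^-1` B = \bigcup_(i in [set i | B (q i)]) c @^-1` [set i]).
    by apply: fin_bigcup_measurable => //; exact: finite_finset.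
  by apply/seteqP; split => [t Bt|t [i Bi ct]]; [exists (c t)|rewrite /= ct].
have mpqc := measurableT_comp mpsi mqc.
have [la laE] := exists_pushforward hp mu mqc.
have [la' la'E] := exists_pushforward hp mu mpqc.
have Phila : Phi la = la'.
  exact: (isometry_of_finite_support hn hp iPhi ipsi Phidirac qP mqc laE la'E).
(* The common approximant: [Phi mu] is as close to [la' = Phi la] as [mu] is to [la], and [nu] is
   close to [la'] because [psi] preserves the displacements. *)
exists la'; split.
  rewrite -Phila (isometry_optimal_cost hp iPhi.2); apply: le_lt_trans rp.
  by apply: (@optimal_cost_pushforward_lt _ _ _ hp _ _ mu id (q \o c)).
apply: le_lt_trans rp.
apply: (@optimal_cost_pushforward_lt _ _ _ hp _ _ mu psi (psi \o (q \o c))) =>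
  //.
by move=> t; rewrite /= psiE.
Qed.
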